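(* Let $G_0$ be a connected graph with edges $e_0,e_1$, and let $G_n$ ($n\ge 1$) be the ladder $GL_n$ or the cross $GC_n$ constructed from $G_0,e_0,e_1$. Suppose that $f_{G_n}(x)=f_{G_0}(x)\,f_{{\cal S}_j^n}(x)$ for $j=1$ or $j=6$. If $f_{G_0}(x)$ is log-concave (respectively, unimodal), then $f_{G_n}(x)$ is log-concave (respectively, unimodal).
   Context: For a graph $G$ let $g_i(G)$ be the number of 2-cell embeddings of $G$ on the orientable surface of genus $i$ (embeddings counted as rotation systems), let $\gamma,\gamma_M$ be the minimum and maximum genus of $G$, and let $f_G(x)=\sum_{i=\gamma}^{\gamma_M}g_i(G)x^i$ be its genus polynomial. Ladders and crosses: given edges $e_0,e_1$ of a connected graph $G_0$, add (subdividing) vertices $u_1,\dots,u_n$ in sequence on $e_0$ and $v_1,\dots,v_n$ in sequence on $e_1$. Adding the edges $u_lv_l$, $1\le l\le n$ (parallel rungs), gives the ladder $GL_n$; adding instead the edges $u_lv_{n-l+1}$, $1\le l\le n$, gives the cross $GC_n$. Ladder surfaces: a surface is represented by a cyclic word in which every occurring letter $x$ appears exactly once as $x$ and exactly once as $x^-$; it is the closed orientable surface obtained from a polygon with boundary labelled by the word by identifying each side $x$ with the side $x^-$ (orientation reversed). Let $a,a_1,a_2,\dots$ be distinct letters. For subsets $K,T\subseteq\{1,\dots,n\}$ put: $R_1^n$ = product of the $a_k$, $k\in K$, in decreasing order of index; $R_2^n$ = product of the $a_k$, $k\notin K$, in increasing order; $R_3^n$ = product of the $a_t^-$, $t\in T$,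 in decreasing order; $R_4^n$ = product of the $a_t^-$, $t\notin T$, in increasing order. Let ${\cal S}_1^n=\{R_1^nR_2^nR_3^nR_4^n\}$ and ${\cal S}_6^n=\{aR_1^nR_4^na^-R_2^nR_3^n\}$, with $(K,T)$ running over all $4^n$ pairs of subsets, counted with multiplicity. $f_{{\cal S}_j^n}(x)=\sum_i g_{i_j}(n)x^i$, where $g_{i_j}(n)$ is the number of surfaces of genus $i$ in ${\cal S}_j^n$. A polynomial is log-concave (unimodal) if its coefficient sequence is. A finite sequence of nonnegative numbers is log-concave if $a_i^2\ge a_{i-1}a_{i+1}$ for all interior $i$, and unimodal if it is weakly increasing up to a maximal value and weakly decreasing afterwards. *)

(* Defs.v *)
From HB Require Import structures.
From mathcomp Require Import all_boot all_order all_algebra all_fingroup.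

Set Implicit Arguments.
Unset Strict Implicit.
Unset Printing Implicit Defensive.

Import GRing.Theory.
Local Open Scope ring_scope.

(* A finite multigraph; loops and parallel edges are allowed.  The orientation
   from [tail e] to [head e] is only a reference direction. *)
Record graph := Graph {
  vertex : finType;
  edge : finType;
  tail : edge -> vertex;
  head : edge -> vertex }.

Definition adj (G : graph) : rel (vertex G) :=
  fun x y => [exists e : edge G,
    ((tail e == x) && (head e == y)) || ((tail e == y) && (head e == x))].

Definition connected_graph (G : graph) : Prop :=
  (0 < #|vertex G|)%N /\ forall x y : vertex G, connect (@adj G) x y.

(* Half-edges: [(e, false)] starts at [tail e], [(e, true)] at [head e]. *)
Definition dart (G : graph) : finType := (edge G * bool)%type.

Definition origin (G : graph) (d : dart G) : vertex G :=
  if d.2 then head d.1 else tail d.1.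

Definition flip (T : Type) (x : T * bool) : T * bool := (x.1, ~~ x.2).

Lemma flip_inj (T : Type) : injective (@flip T).
Proof. by move=> [x b] [y c] [-> /negb_inj ->]. Qed.

(* A rotation system is a cyclic order on the darts issued from each vertex,
   i.e. a permutation of the darts whose cycles are exactly the vertex stars. *)
Definition rotations (G : graph) : {set {perm dart G}} :=
  [set s | [forall d : dart G,
    porbit s d == [set d' | origin d' == origin d]]].

(* Face tracing: traverse the edge, then turn at the vertex which is reached. *)
Definition face_perm (G : graph) (s : {perm dart G}) : {perm dart G} :=
  (perm (@flip_inj (edge G)) * s)%g.

(* Euler's formula |V| - |E| + |F| = 2 - 2g, solved for g. *)
Definition rotation_genus (G : graph) (s : {perm dart G}) : nat :=
  ((2 + #|edge G|) - (#|vertex G| + #|porbits (face_perm s)|))./2.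

Definition embeddings (G : graph) (i : nat) : nat :=
  #|[set s in rotations G | rotation_genus s == i]|.

Definition max_genus (G : graph) : nat :=
  \max_(s in rotations G) rotation_genus s.

Definition min_genus (G : graph) : nat :=
  \big[minn/max_genus G]_(s in rotations G) rotation_genus s.

Definition genus_poly (G : graph) : {poly nat} :=
  \sum_(min_genus G <= i < (max_genus G).+1) embeddings G i *: 'X^i.

(* Vertices: those of [G], then u_1, ..., u_n, then v_1, ..., v_n.
   Edges: those of [G] other than [e0] and [e1], the n+1 segments of the
   subdivided [e0], those of [e1], and the rungs.  The indices are shifted to
   start from 0, and the l-th rung joins u_l to v_(r l).  This is meaningful
   only for [e0 != e1]. *)
Section Rungs.
Variables (G : graph) (e0 e1 : edge G) (n : nat) (r : 'I_n -> 'I_n).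

Definition rung_vertex : finType := (vertex G + 'I_n + 'I_n)%type.
Definition rung_edge : finType :=
  ({e : edge G | (e != e0) && (e != e1)} + 'I_n.+1 + 'I_n.+1 + 'I_n)%type.

Definition old_vertex (x : vertex G) : rung_vertex := inl (inl x).
Definition u_vertex (l : 'I_n) : rung_vertex := inl (inr l).
Definition v_vertex (l : 'I_n) : rung_vertex := inr l.

(* The k-th segment runs from the (k-1)-th to the k-th subdividing vertex,
   except that the first starts at the old tail and the last ends at the old
   head; [unlift ord0 k] is k-1 and [unlift ord_max k] is k when defined. *)
Definition rung_tail (e : rung_edge) : rung_vertex :=
  match e with
  | inl (inl (inl f)) => old_vertex (tail (val f))
  | inl (inl (inr k)) =>
      if unlift ord0 k is Some l then u_vertex l else old_vertex (tail e0)
  | inl (inr k) =>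
      if unlift ord0 k is Some l then v_vertex l else old_vertex (tail e1)
  | inr l => u_vertex l
  end.

Definition rung_head (e : rung_edge) : rung_vertex :=
  match e with
  | inl (inl (inl f)) => old_vertex (head (val f))
  | inl (inl (inr k)) =>
      if unlift ord_max k is Some l then u_vertex l else old_vertex (head e0)
  | inl (inr k) =>
      if unlift ord_max k is Some l then v_vertex l else old_vertex (head e1)
  | inr l => v_vertex (r l)
  end.

Definition rung_graph : graph := Graph rung_tail rung_head.
End Rungs.

Definition ladder (G : graph) (e0 e1 : edge G) (n : nat) : graph :=
  rung_graph e0 e1 (fun l : 'I_n => l).

Definition cross (G : graph) (e0 e1 : edge G) (n : nat) : graph :=
  rung_graph e0 e1 (@rev_ord n).

(* Signed letters: [None] is the letter a, [Some k] is a_(k+1), and the boolean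
   [true] marks the exponent minus. *)
Definition letter (n : nat) : finType := (option 'I_n * bool)%type.

(* [w] is a cyclic word using each of its letters once with each sign.  A side
   y is glued to the side y^- in reverse, so the corner at the start of y is
   identified with the corner at the end of y^-, which is the start of the
   successor of y^-.  The glued surface has one face, [size w]./2 edges, and
   as many vertices as there are classes of corners; the genus is then given
   by Euler's formula. *)
Definition corner_next (n : nat) (w : seq (letter n)) (y : letter n) :
  letter n := next w (flip y).

Definition word_genus (n : nat) (w : seq (letter n)) : nat :=
  ((1 + (size w)./2) - fcard (corner_next w) (mem w))./2.

Section Words.
Variables (n : nat) (K T : {set 'I_n}).

Definition pos (k : 'I_n) : letter n := (Some k, false).
Definition neg (k : 'I_n) : letter n := (Some k, true).

(* [enum] lists ordinals in increasing order. *)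
Definition R1 : seq (letter n) := map pos (rev (enum K)).
Definition R2 : seq (letter n) := map pos (enum (~: K)).
Definition R3 : seq (letter n) := map neg (rev (enum T)).
Definition R4 : seq (letter n) := map neg (enum (~: T)).

Definition word1 : seq (letter n) := R1 ++ R2 ++ R3 ++ R4.
Definition word6 : seq (letter n) :=
  (None, false) :: R1 ++ R4 ++ (None, true) :: R2 ++ R3.
End Words.

(* A family of surfaces indexed by the pairs (K, T), hence counted with
   multiplicity. *)
Section Surfaces.
Variables (n : nat) (word : {set 'I_n} -> {set 'I_n} -> seq (letter n)).

Definition surfaces (i : nat) : nat :=
  #|[set KT : {set 'I_n} * {set 'I_n} | word_genus (word KT.1 KT.2) == i]|.

Definition surface_poly : {poly nat} :=
  \sum_(0 <= i < (\max_(KT : {set 'I_n} * {set 'I_n})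
                    word_genus (word KT.1 KT.2)).+1) surfaces i *: 'X^i.
End Surfaces.

Definition fS1 (n : nat) : {poly nat} := surface_poly (@word1 n).
Definition fS6 (n : nat) : {poly nat} := surface_poly (@word6 n).

Definition log_concave (s : seq nat) : Prop :=
  forall i, (i.+2 < size s)%N ->
    (nth 0 s i * nth 0 s i.+2 <= nth 0 s i.+1 ^ 2)%N.

Definition unimodal (s : seq nat) : Prop :=
  exists m : nat,
    (forall i, (i.+1 < size s)%N -> (i < m)%N ->
       (nth 0 s i <= nth 0 s i.+1)%N) /\
    (forall i, (i.+1 < size s)%N -> (m <= i)%N ->
       (nth 0 s i.+1 <= nth 0 s i)%N).

(* Main.v *)
(** Write A_n for the genus polynomial of S_1^n.  Reading off the position of
    the letter a_n in a word of S_1^n, the pair a_n, a_n^- either cancels or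
    surrounds one of the two halves of the remaining word.  In the second case
    the letter a_(n-1) forms a handle with a_n, so that
    A_n = 2 A_(n-1) + 8 x A_(n-2).  The same analysis for S_6^n, followed by
    the relabelling k -> n + 1 - k, gives 4 f_(S_6^n) = A_(n+1).  The
    recurrence shows by induction that A_n is log-concave without internal
    zeros, because the coefficients of A_n and A_(n-1) interlace.

    Convolution with such a sequence preserves unimodality, and it preserves
    log-concavity of sequences without internal zeros.  The genus polynomial
    of G_0 has no internal zeros: any two rotation systems are joined by
    exchanges of two darts at a vertex, and each exchange changes the number of
    faces by at most two, hence the genus by at most one (Duke). *)

(* The obstacle on the surface side is that [word_genus] truncates a subtraction and a halving, so a
   reduction of words transports its value only where Euler's formula is known to hold exactly. That
   formula is therefore kept as an additive equation, [has_genus], and its solvability for the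
   ladder words is obtained by stripping letters, along with the recurrences; no general parity
   argument is made. Only three reductions occur: removing a handle, cancelling an adjacent pair,
   merging two parallel sides. Each compares the orbits of two corner permutations. The factor 4
   relating the two families comes from their recurrences. With B_n for the polynomial of S_6^n, B_n
   = 2 B_(n-1) + 2 x A_(n-1), and multiplying by 4 turns this into the recurrence of A one index
   later, with 4 B_0 = 4 = A_1. On the side of sequences, log-concavity is used as nonnegativity of
   all 2 by 2 minors of shifts: this is what the Cauchy-Binet identity propagates through a
   convolution. *)
Require Import Defs.
From mathcomp Require Import all_boot all_order all_algebra all_fingroup.
From mathcomp Require Import zify.

Set Implicit Arguments.
Unset Strict Implicit.
Unset Printing Implicit Defensive.

Import Order.TTheory GRing.Theory Num.Theory.

(** * Log-concave sequences without internal zeros *)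

(* Polya frequency of order 2: unlike [log_concave], this forbids internal zeros. *)
Definition pf2 (f : nat -> nat) :=
  forall i j, i <= j -> f i * f j.+1 <= f i.+1 * f j.

(** Log-concavity compares consecutive ratios of f. Chaining these comparisons divides by the
    intermediate value [f j'.+1], and the absence of internal zeros settles the case where it
    vanishes. *)
Lemma pf2_log_concave (f : nat -> nat) :
    (forall i j k, i <= j <= k -> f i != 0 -> f k != 0 -> f j != 0) ->
    (forall i, f i * f i.+2 <= f i.+1 ^ 2) -> pf2 f.
Proof.
move=> nogap lc i j /subnKC <-; elim: (j - i) => [|d IH].
  by rewrite addn0 mulnC.
rewrite addnS; set j' := i + d in IH *.
have [z|fpos] := posnP (f j'.+1).
  have [->|fi] := eqVneq (f i) 0; first by rewrite mul0n.
  have [->|fj] := eqVneq (f j'.+2) 0; first by rewrite muln0.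
  by move: (nogap i j'.+1 j'.+2); rewrite z => /(_ _ fi fj); rewrite /j'; lia.
rewrite -(leq_pmul2r fpos).
have := lc j'; rewrite expnS expn1 => H.
have H1 : f i * f j'.+1 * f j'.+2 <= f i.+1 * f j' * f j'.+2.
  by rewrite leq_mul2r IH orbT.
have H2 : f i.+1 * (f j' * f j'.+2) <= f i.+1 * (f j'.+1 * f j'.+1).
  by rewrite leq_mul2l H orbT.
by lia.
Qed.

(** Nonzero values at both ends make the left side of the [pf2] inequality positive, hence [f i.+1]
    is nonzero and the left end can move inwards. *)
Lemma pf2_no_gap (f : nat -> nat) (i j k : nat) :
  pf2 f -> i <= j <= k -> f i != 0 -> f k != 0 -> f j != 0.
Proof.
move=> pf; move dE: (k - i) => d; elim: d i k dE => [|d IH] i k dE.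
  by move=> ijk fi _; have <- : i = j by lia.
have [->//|ij] := eqVneq i j => /andP[le_ij jk] fi fk.
case: k => [|k] in dE jk fk *; first by lia.
have ik : i <= k by lia.
have : 0 < f i.+1 * f k.
  by apply: leq_trans (pf _ _ ik); rewrite muln_gt0 !lt0n fi fk.
rewrite muln_gt0 !lt0n => /andP[fi1 fk1].
by apply: (IH i.+1 k.+1) => //; lia.
Qed.

(** The difference of the two sides is the sum over k < l of (a_k b_l - a_l b_k)(u_k v_l - u_l v_k),
    a product of two nonnegative minors. Doubling both sides symmetrizes the sums in k and l. *)
Lemma cauchy_binet_le (N : nat) (a b u v : nat -> nat) :
    (forall k l, k <= l -> a l * b k <= a k * b l) ->
    (forall k l, k <= l -> v k * u l <= u k * v l) ->
  (\sum_(k < N) a k * v k) * (\sum_(k < N) b k * u k) <=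
  (\sum_(k < N) a k * u k) * (\sum_(k < N) b k * v k).
Proof.
move=> ab uv.
have dbl (x y : nat -> nat) : ((\sum_(k < N) x k) * (\sum_(k < N) y k)).*2 =
    \sum_(k < N) \sum_(l < N) (x k * y l + x l * y k).
  rewrite -addnn {2}[_ * _]mulnC big_distrlr/= [in X in _ + X]big_distrlr/=.
  rewrite -big_split/=; apply: eq_bigr => k _; rewrite -big_split/=.
  by apply: eq_bigr => l _; rewrite [y k * _]mulnC.
rewrite -leq_double (dbl (fun k => a k * v k) (fun k => b k * u k)).
rewrite (dbl (fun k => a k * u k) (fun k => b k * v k)).
(* This is (X - Y)(U - W) >= 0 without subtraction. *)
have rearr X Y U W : Y <= X -> W <= U -> X * W + Y * U <= X * U + Y * W.
  by move=> /subnKC<- /subnKC<-; nia.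
apply: leq_sum => k _; apply: leq_sum => l _.
have [kl|lk] := leqP k l.
  by have := rearr _ _ _ _ (ab _ _ kl) (uv _ _ kl); nia.
by have := rearr _ _ _ _ (ab _ _ (ltnW lk)) (uv _ _ (ltnW lk)); nia.
Qed.

(** The likelihood ratio order: f / g is weakly decreasing, written without division. *)
Definition ratio_le (f g : nat -> nat) :=
  forall i j, i <= j -> f j * g i <= f i * g j.

Definition shift (f : nat -> nat) (i : nat) := if i is i'.+1 then f i' else 0.

(** Here f and g stand for A_(n+1) and A_n, and [shift g] for the coefficients of x A_n. The two
    ratio conditions are the coefficientwise analogue of interlacing roots. Positivity of [f 0]
    makes the support of f an initial segment. *)
Definition pf2_interlaced (f g : nat -> nat) :=
  [/\ 0 < f 0, pf2 f, pf2 g, ratio_le g f & ratio_le f (shift g)].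

(* These conditions are what makes the recurrence h = p f + q x g go through:
   each of them for (h, f) reduces to the others for (f, g). *)
Lemma pf2_interlaced_step (p q : nat) (f g h : nat -> nat) :
    0 < p -> (forall i, h i = p * f i + q * shift g i) ->
  pf2_interlaced f g -> pf2_interlaced h f.
Proof.
move=> p0 hE [f0 pf pg gf fg].
have pg' i j : i <= j -> shift g i * shift g j.+1 <= shift g i.+1 * shift g j.
  by case: i => [|i]//; case: j => [|j]//= ij; exact: pg.
split=> //; first by rewrite hE muln0 addn0 muln_gt0 p0.
- move=> i j; rewrite leq_eqVlt => /predU1P[->|ij]; first by rewrite mulnC.
  (* Since [f 0] is positive, a zero of f at j forces zeros of f at j+1 and of g at j, so [h j.+1]
     vanishes. *)
  rewrite !hE; have [fj|fj] := posnP (f j).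
    have fj1 : f j.+1 = 0.
      by have := pf 0 j (leq0n _); rewrite fj muln0; case: (f j.+1) => //; nia.
    have gj : g j = 0.
      have := gf 0 j (leq0n _); rewrite fj muln0 leqn0 muln_eq0.
      by rewrite (gtn_eqF f0) orbF => /eqP.
    by rewrite /= fj fj1 gj !muln0.
  have fi : 0 < f i.
    have := @pf2_no_gap f 0 i j pf; rewrite -!lt0n; apply=> //; lia.
  have H1 := pf _ _ (ltnW ij); have H2 := pg' _ _ (ltnW ij).
  have H3 := gf _ _ (ltnW ij); have H4 := fg _ _ (ltnW ij).
  (* Product of [H4] and [H1], after cancelling the positive factors [f i] and [f j]. *)
  have H5 : f j.+1 * shift g i <= f i.+1 * shift g j.
    rewrite -(leq_pmul2r fj) -(leq_pmul2r fi).
    have := leq_mul H4 H1; nia.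
  rewrite /= in H2 *.
  rewrite !mulnDl !mulnDr.
  (* The four products on each side are matched one to one. Each mixed product, with f and g in one
     order, is bounded by a mixed product with f and g in the other order. *)
  have E1 : p * f i * (p * f j.+1) <= p * f i.+1 * (p * f j) by nia.
  have E2 : q * shift g i * (q * g j) <= q * g i * (q * shift g j).
    by rewrite mulnACA [leqRHS]mulnACA leq_mul2l H2 orbT.
  have E3 : p * f i * (q * g j) <= q * g i * (p * f j).
    by rewrite mulnACA [leqRHS]mulnACA (mulnC q p) leq_mul2l (mulnC (f i)) H3 orbT.
  have E4 : q * shift g i * (p * f j.+1) <= p * f i.+1 * (q * shift g j).
    rewrite mulnACA [leqRHS]mulnACA (mulnC q p) leq_mul2l.
    by rewrite (mulnC (shift g i)) H5 orbT.
  by move: E1 E2 E3 E4; lia.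
- move=> i j ij; rewrite !hE !mulnDr ![f _ * (p * _)]mulnCA ![f _ * (q * _)]mulnCA.
  by rewrite [f i * f j]mulnC leq_add2l leq_mul2l fg ?orbT.
move=> i j ij; case: i ij => [|i]; first by rewrite muln0.
case: j => [|j]//; rewrite ltnS => ij.
rewrite /shift !hE !mulnDl -!mulnA; apply: leq_add; rewrite leq_mul2l.
  by rewrite mulnC pf ?orbT.
by rewrite gf ?orbT.
Qed.

(** * Products with a polynomial whose coefficients are [pf2] *)

Local Open Scope ring_scope.

(** The coefficients of index i, i+1 (twice) and i+2 of the product are the four entries of a matrix
    product: two consecutive shifts of p reversed, times q and its shift. Cauchy-Binet compares its
    diagonal and antidiagonal. *)
Lemma pf2_mul_log_concave (p q : {poly nat}) :
  pf2 (nth 0 p) -> pf2 (nth 0 q) -> log_concave (p * q).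
Proof.
move=> pp pq i _.
(* The test is essential: past r, the truncated [r - k] would return the constant coefficient of
   p. *)
pose tp r k := if (k <= r)%N then p`_(r - k) else 0.
pose sh k := if k is k'.+1 then q`_k' else 0.
have H0 r N : (r < N)%N -> (p * q)`_r = (\sum_(k < N) tp r k * nth 0 q k)%N.
  move=> rN; rewrite coefMr (big_ord_widen N (fun k => p`_(r - k) * q`_k)) //.
  rewrite big_mkcond/=; apply: eq_bigr => k _; rewrite /tp ltnS.
  by case: ifP; rewrite ?mul0n.
have H1 r N : (r < N)%N ->
    (p * q)`_r = (\sum_(k < N.+1) tp r.+1 k * sh k)%N.
  move=> rN; rewrite big_ord_recl muln0 add0n (H0 r N)//.
have := @cauchy_binet_le i.+3 (tp i.+1) (tp i.+2) (nth 0 q) sh.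
rewrite -(H0 i.+2 i.+3)// -(H0 i.+1 i.+3)// -(H1 i.+1 i.+2)// -(H1 i i.+2)//.
rewrite expnS expn1; apply=> k l kl.
  rewrite /tp; case: ifP; rewrite ?mul0n// => li.
  rewrite !ifT; try by lia.
  have := pp (i.+1 - l)%N (i.+1 - k)%N.
  by rewrite -!subSn; try lia; apply; lia.
case: k kl => [|k]; first by rewrite mul0n.
by case: l => [//|l] kl /=; apply: pq.
Qed.

Definition has_mode (f : nat -> nat) (m : nat) :=
  (forall i, i < m -> f i <= f i.+1)%N /\ (forall i, m <= i -> f i.+1 <= f i)%N.

Lemma unimodalP (p : {poly nat}) :
  unimodal p <-> exists m, has_mode (nth 0 p) m.
Proof.
split=> -[m [up down]]; last first.
  by exists m; split=> i _ ?; [apply: up|apply: down].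
(* Beyond the list the coefficients are zero, which creates a descent at the last index; capping the
   mode there puts this drop on the descending side. *)
exists (minn m (size p).-1); split=> i.
  by rewrite ltn_min => /andP[im ip]; apply: up => //; move: ip; case: size.
rewrite geq_min => mi; have [ip|ip] := ltnP i.+1 (size p).
  by apply: down => //; lia.
by rewrite [leqLHS]nth_default.
Qed.

(** The mode is the first descent at or after m: before it f ascends by minimality, and after it
    descents persist. *)
Lemma has_mode_exists (f : nat -> nat) (m : nat) :
    (forall n, n < m -> f n <= f n.+1)%N ->
    (forall n, m <= n -> f n.+1 <= f n -> f n.+2 <= f n.+1)%N ->
    (exists n, m <= n /\ f n.+1 <= f n)%N -> exists m', has_mode f m'.
Proof.
move=> up down [n0 [mn0 d0]].
have ex : exists n, (m <= n)%N && (f n.+1 <= f n)%N by exists n0; rewrite mn0.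
case: (ex_minnP ex) => M /andP[mM dM] minM; exists M; split=> i.
  move=> iM; have [/up//|mi] := ltnP i m.
  by rewrite leqNgt; apply/negP => /ltnW d; have := minM i; rewrite mi d; lia.
elim: i => [|i IH]; first by rewrite leqn0 => /eqP M0; rewrite M0 in dM.
rewrite leq_eqVlt => /predU1P[<-//|Mi].
by apply: down; [lia|apply: IH].
Qed.

(* The differences of [p] change sign once, from + to -, and so do their
   convolutions with the totally positive kernel [q]. *)
Lemma pf2_mul_unimodal (p q : {poly nat}) :
    q`_0 != 0 -> pf2 (nth 0 q) -> unimodal p -> unimodal (p * q).
Proof.
move=> q0 pf2q /unimodalP[m [up down]]; apply/unimodalP.
(* Signed differences of p, with the value 0 before index 0; [e] below is their convolution with q,
   that is, the differences of the product. *)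
pose d k : int := (p`_k : int) - (if k is k'.+1 then (p`_k' : int) else 0).
have dpos k : (k <= m)%N -> 0 <= d k.
  by case: k => [|k] km; rewrite /d; [|have := up _ km]; lia.
have dneg k : (m < k)%N -> d k <= 0.
  by case: k => [|k]// km; rewrite /d; have := down _ km; lia.
pose e n : int := \sum_(k < n.+1) d k * (q`_(n - k) : int).
have hE n : ((p * q)`_n : int) = \sum_(k < n.+1) (p`_k : int) * (q`_(n - k) : int).
  rewrite coefM (big_morph Posz PoszD (erefl _)).
  by apply: eq_bigr => k _; rewrite PoszM.
have eE n : e n.+1 = ((p * q)`_n.+1 : int) - ((p * q)`_n : int).
  rewrite !hE /e.
  under eq_bigr => k _ do rewrite /d mulrBl.
  rewrite sumrB; congr (_ - _); rewrite big_ord_recl mul0r add0r.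
  by apply: eq_bigr.
have epos n : (n <= m)%N -> 0 <= e n.
  move=> nm; apply: sumr_ge0 => k _; apply: mulr_ge0 => //; apply: dpos.
  by have := ltn_ord k; lia.
have step n : (m <= n)%N -> e n <= 0 -> e n.+1 <= 0.
  move=> mn en.
  (* Termwise comparison with the mode m as pivot: the minors of q change sign exactly where [d]
     does, so every term goes the same way. The extra term k = n+1 of [e n.+1] is nonpositive. *)
  have key : e n.+1 * (q`_(n - m) : int) <= (q`_(n.+1 - m) : int) * e n.
    rewrite /e mulr_suml big_ord_recr/= mulr_sumr.
    rewrite -[leRHS]addr0; apply: lerD; last first.
      rewrite -mulrA; apply: mulr_le0_ge0; last exact: mulr_ge0.
      by apply: dneg; lia.
    apply: ler_sum => k _; have := ltn_ord k; rewrite ltnS => kn.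
    rewrite -mulrA [leRHS]mulrCA; have [km|mk] := leqP k m.
      apply: ler_wpM2l; first exact: dpos.
      rewrite -!PoszM lez_nat mulnC.
      by have := pf2q (n - m)%N (n - k)%N; rewrite -!subSn//; apply; lia.
    apply: ler_wnM2l; first exact: dneg.
    rewrite -!PoszM lez_nat mulnC [leqRHS]mulnC.
    have := pf2q (n - k)%N (n - m)%N; rewrite -!subSn//.
    by move=> H; rewrite [leqRHS]mulnC; apply: H; lia.
  have [qz|qn] := eqVneq (q`_(n - m)) 0; last first.
    have : e n.+1 * (q`_(n - m) : int) <= 0.
      by apply: le_trans key _; apply: mulr_ge0_le0.
    by rewrite pmulr_lle0// ltz_nat lt0n.
  apply: sumr_le0 => k _; have := ltn_ord k; rewrite ltnS => kn.
  have [km|mk] := leqP k m; last by apply: mulr_le0_ge0 => //; exact: dneg.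
  have [->|qk] := eqVneq (q`_(n.+1 - k)) 0; first by rewrite mulr0.
  have := @pf2_no_gap _ 0 (n - m)%N (n.+1 - k)%N pf2q; rewrite qz.
  by move=> /(_ _ q0 qk); lia.
apply: (@has_mode_exists _ m).
- by move=> n nm; have := epos _ nm; rewrite eE; lia.
- by move=> n mn dn; have := step n.+1; rewrite !eE; lia.
exists (maxn m (size (p * q)%R)); split; first exact: leq_maxl.
by rewrite [leqLHS]nth_default ?leq0n // leqW ?leq_maxr.
Qed.

(** The pair (A_(n+1), A_n) in the notation of the overview. The initial 4 is A_1: with one letter,
    all four choices of K and T give a sphere. *)
Fixpoint ladder_polys (n : nat) : {poly nat} * {poly nat} :=
  if n is n'.+1 then
    let: (p, q) := ladder_polys n' in (p *+ 2 + q * 'X *+ 8, p)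
  else (4%:R, 1).

Lemma ladder_polys_interlaced (n : nat) :
  pf2_interlaced (nth 0 (ladder_polys n).1) (nth 0 (ladder_polys n).2).
Proof.
elim: n => [|n].
  rewrite /= polyseq1 -polyC_natr polyseqC /=.
  by split=> // [i j|i j|i j|i j]; case: i => [|[|i]]//; case: j => [|[|j]].
rewrite [ladder_polys n.+1]/=; case: (ladder_polys n) => p q /=.
apply: (@pf2_interlaced_step 2 8) => // i.
have mulnE a b : (a : nat) *+ b = (b * a)%N by rewrite -mulr_natl natn.
by rewrite coefD !coefMn coefMX !mulnE; case: i.
Qed.

Lemma pf2_scale (c : nat) (f g : nat -> nat) :
  (0 < c)%N -> (forall i, f i = c * g i)%N -> pf2 f -> pf2 g.
Proof.
move=> c0 fE pf i j ij; have := pf _ _ ij; rewrite !fE mulnACA [leqRHS]mulnACA.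
by rewrite leq_pmul2l// muln_gt0 c0.
Qed.

Local Close Scope ring_scope.

(** * Interpolation of the genus of rotation systems *)

Local Open Scope group_scope.

Lemma porbit_fconnect (T : finType) (s : {perm T}) (x y : T) :
  (y \in porbit s x) = fconnect s x y.
Proof.
apply/porbitP/idP => [[i ->]|/iter_findex <-].
  by rewrite permX fconnect_iter.
by exists (findex s x y); rewrite permX.
Qed.

Lemma porbit_conjg (T : finType) (s t : {perm T}) (x : T) :
  porbit (s ^ t) (t x) = t @: porbit s x.
Proof.
apply/setP => y; apply/porbitP/imsetP => [[i ->]|[z /porbitP[i ->] ->]].
  by exists ((s ^+ i) x); rewrite ?mem_porbit// -conjXg permJ.
by exists i; rewrite -conjXg permJ.
Qed.

Lemma card_porbits_conjg (T : finType) (s t : {perm T}) :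
  #|porbits (s ^ t)| = #|porbits s|.
Proof.
rewrite -(card_imset (porbits s) (imset_inj (@perm_inj _ t))).
apply: eq_card => A; apply/imsetP/imsetP => [[x _ ->]|[_ /imsetP[x _ ->] ->]].
  exists (porbit s (t^-1 x)); first exact: imset_f.
  by rewrite -porbit_conjg permKV.
by exists (t x); rewrite // porbit_conjg.
Qed.

Lemma card_porbits_mulC (T : finType) (s t : {perm T}) :
  #|porbits (s * t)| = #|porbits (t * s)|.
Proof. by rewrite -(card_porbits_conjg (s * t) s) conjgE -mulgA mulKg. Qed.

Lemma card_porbits_tperm (T : finType) (s : {perm T}) (x y : T) :
  #|porbits (tperm x y * s)| <= #|porbits s|.+1 /\
  #|porbits s| <= #|porbits (tperm x y * s)|.+1.
Proof.
have := porbits_mul_tperm s x y => /=.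
have [->|_] := eqVneq x y; first by rewrite porbit_id; lia.
by case: (_ \notin _) => /=; lia.
Qed.

(** Up to cyclic conjugation, which keeps the number of orbits, conjugating s by a transposition
    multiplies f s by two transpositions, each of which merges two orbits or splits one. *)
Lemma card_porbits_conj_tperm (T : finType) (f s : {perm T}) (x y : T) :
  #|porbits (f * s ^ tperm x y)| <= #|porbits (f * s)|.+2 /\
  #|porbits (f * s)| <= #|porbits (f * s ^ tperm x y)|.+2.
Proof.
set t := tperm x y; rewrite conjgE tpermV.
have -> : #|porbits (f * (t * (s * t)))| = #|porbits (t * (f * (t * s)))|.
  by rewrite (card_porbits_mulC t) !mulgA.
have [] := card_porbits_tperm (f * (t * s)) x y.
have [] := card_porbits_tperm (s * f) x y.
have -> : #|porbits (tperm x y * (s * f))| = #|porbits (f * (t * s))|.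
  by rewrite (card_porbits_mulC f) !mulgA.
by rewrite (card_porbits_mulC s f) -/t => ????; split; lia.
Qed.

Section RotationSystems.
Variable G : graph.

Definition star_preserving (t : {perm dart G}) :=
  forall d, origin (t d) = origin d.

Lemma rotationsP (s : {perm dart G}) :
  reflect (forall d d', (d' \in porbit s d) = (origin d' == origin d))
          (s \in rotations G).
Proof.
rewrite inE; apply: (iffP forallP) => [H d d'|H d].
  by rewrite (eqP (H d)) inE.
by apply/eqP/setP => d'; rewrite H inE.
Qed.

Lemma rotations_conjg (s t : {perm dart G}) :
  star_preserving t -> s \in rotations G -> s ^ t \in rotations G.
Proof.
move=> tP /rotationsP sP; apply/rotationsP => d d'.
rewrite -(permKV t d) -(permKV t d') porbit_conjg mem_imset; last exact: perm_inj.
by rewrite sP !tP.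
Qed.

(** Both permutations have the vertex stars as cycles. From a common root of each star, the i-th
    dart along s is sent to the i-th dart along s'. *)
Lemma rotations_conjugate (s s' : {perm dart G}) :
    s \in rotations G -> s' \in rotations G ->
  exists2 t, star_preserving t & s' = s ^ t.
Proof.
move=> /rotationsP sP /rotationsP s'P.
have conE d d' : fconnect s d d' = (origin d' == origin d).
  by rewrite -porbit_fconnect sP.
have conE' d d' : fconnect s' d d' = (origin d' == origin d).
  by rewrite -porbit_fconnect s'P.
pose r := froot s.
have r_con d : fconnect s (r d) d.
  by rewrite (fconnect_sym (@perm_inj _ s)); exact: connect_root.
have rE d d' : origin d = origin d' -> r d = r d'.
  move=> dd'; apply/eqP; rewrite root_connect; last exact/fconnect_sym/perm_inj.
  by rewrite conE dd'.
have ordE d : fingraph.order s d = fingraph.order s' d.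
  by apply: eq_card => d'; exact: etrans (conE d d') (esym (conE' d d')).
pose i d := findex s (r d) d.
have i_lt d : i d < fingraph.order s (r d) by exact: findex_max.
pose f d := iter (i d) s' (r d).
have f_origin d : origin (f d) = origin d.
  have : fconnect s' (r d) (f d) by exact: fconnect_iter.
  by rewrite conE' => /eqP ->; have := r_con d; rewrite conE => /eqP ->.
have f_inj : injective f.
  move=> d d' fdd'; have rdd' : r d = r d' by rewrite (rE d d')// -(f_origin d) fdd' f_origin.
  have : i d = i d'.
    have := i_lt d; have := i_lt d'; rewrite -rdd' ordE => l l'.
    by rewrite -(findex_iter l) -(findex_iter l') -/(f d) fdd' /f -rdd'.
  by move=> idd'; rewrite -(iter_findex (r_con d)) -(iter_findex (r_con d'))
    -/(i d) -/(i d') idd' rdd'.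
exists (perm f_inj) => [d|]; first by rewrite permE f_origin.
apply/permP => d; rewrite -{2}[d](permKV (perm f_inj)) permJ.
set e := (perm f_inj)^-1 d; have -> : d = f e.
  by rewrite -(permE f_inj) permKV.
rewrite permE.
have rs : r (s e) = r e.
  by apply: rE; apply/eqP; rewrite -conE fconnect1.
have se : s e = iter (i e).+1 s (r e) by rewrite iterS iter_findex.
rewrite /f rs {2}/i rs se.
(* At the last dart of a star the position wraps around to 0; both cycles close there since they
   have the same length. *)
have := i_lt e; rewrite leq_eqVlt => /predU1P[ie|ie]; last first.
  by rewrite findex_iter.
rewrite ie (iter_order (@perm_inj _ s)) findex0/= -iterS ie ordE.
by rewrite iter_order//; exact: perm_inj.
Qed.

(** The number of faces moves by at most two, and the genus depends on it with a factor one half. *)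
Lemma rotation_genus_conj_tperm (s : {perm dart G}) (x y : dart G) :
  rotation_genus (s ^ tperm x y) <= (rotation_genus s).+1 /\
  rotation_genus s <= (rotation_genus (s ^ tperm x y)).+1.
Proof.
have := card_porbits_conj_tperm (perm (@flip_inj (edge G))) s x y.
rewrite /rotation_genus /face_perm.
by set a := #|porbits _|; set b := #|porbits _|; lia.
Qed.

(* Conjugating by a product of transpositions, one at a time, moves the genus
   by steps of size at most one. *)
Lemma rotation_genus_conj_between (m g : nat) (s t : {perm dart G}) :
    #|[pred d | t d != d]| <= m -> star_preserving t -> s \in rotations G ->
    minn (rotation_genus s) (rotation_genus (s ^ t)) <= g ->
    g <= maxn (rotation_genus s) (rotation_genus (s ^ t)) ->
  exists2 s', s' \in rotations G & rotation_genus s' = g.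
Proof.
elim: m g t => [|m IH] g t tm tP sR.
  have -> : t = 1.
    apply/permP => d; rewrite perm1; apply/eqP.
    by move: tm; rewrite leqn0 => /eqP/card0_eq/(_ d)/negbFE.
  by rewrite conjg1 minnn maxnn => *; exists s => //; lia.
have [/pred0P t1|/pred0Pn[x /= tx]] := boolP (pred0b [pred d | t d != d]).
  by apply: IH => //; rewrite (eq_card t1) card0.
(* [t'] fixes x and every fixed point of t, so it moves fewer darts; x and [t x] share their origin,
   so it still preserves stars. *)
pose t' := t * tperm x (t x).
have tE : t = t' * tperm x (t x) by rewrite /t' -mulgA tperm2 mulg1.
have t'P : star_preserving t'.
  by move=> d; rewrite permM -(tP d); case: tpermP => // ->; rewrite tP.
have t'm : #|[pred d | t' d != d]| <= m.
  rewrite -ltnS; apply: leq_trans tm; apply: proper_card.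
  apply/properP; split; last first.
    by exists x; rewrite !inE// permM tpermR eqxx.
  apply/subsetP => u; rewrite !inE; apply: contraNN => /eqP tu.
  rewrite permM tu; case: tpermP => [ux|utx|//].
    by rewrite -ux tu eqxx in tx.
  by move: tx; rewrite utx in tu; rewrite (perm_inj tu) eqxx.
have sE : s ^ t = (s ^ t') ^ tperm x (t x) by rewrite -conjgM -tE.
have stR : (s ^ t') ^ tperm x (t x) \in rotations G.
  by rewrite -sE; exact: rotations_conjg.
move: (IH g t' t'm t'P sR); rewrite sE.
have := rotation_genus_conj_tperm (s ^ t') x (t x).
set a := rotation_genus s; set b := rotation_genus (s ^ t').
set c := rotation_genus (_ ^ tperm _ _) => bc IHb lo hi.
(* As b and c differ by at most one, a value between a and c other than c lies between a and b. *)
have [gc|gc] := eqVneq g c.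
  by exists ((s ^ t') ^ tperm x (t x)).
by apply: IHb; lia.
Qed.

Lemma rotation_genus_between (s s' : {perm dart G}) (g : nat) :
    s \in rotations G -> s' \in rotations G ->
    rotation_genus s <= g <= rotation_genus s' ->
  exists2 s'', s'' \in rotations G & rotation_genus s'' = g.
Proof.
move=> sR s'R /andP[lo hi]; have [t tP s'E] := rotations_conjugate sR s'R.
rewrite s'E in hi.
by apply: (rotation_genus_conj_between (leqnn _) tP sR); lia.
Qed.

End RotationSystems.

Local Close Scope group_scope.
Local Open Scope ring_scope.

Lemma coef_genus_poly (G : graph) (i : nat) :
  (genus_poly G)`_i =
  if (min_genus G <= i <= max_genus G)%N then embeddings G i else 0.
Proof.
rewrite /genus_poly coef_sum; case: ifP => [/andP[lo hi]|out]; last first.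
  rewrite big_nat big1// => j lohi; rewrite coefZ coefXn.
  case: eqP => [ij|]; last by rewrite mulr0.
  by move: lohi out; rewrite ij ltnS => ->.
rewrite (bigD1_seq i)/= ?iota_uniq ?mem_index_iota ?lo//.
rewrite coefZ coefXn eqxx mulr1 big1 ?addr0// => j ji.
by rewrite coefZ coefXn eq_sym (negbTE ji) mulr0.
Qed.

Lemma genus_poly_no_gap (G : graph) (i j k : nat) :
    (i <= j <= k)%N -> (genus_poly G)`_i != 0 -> (genus_poly G)`_k != 0 ->
  (genus_poly G)`_j != 0.
Proof.
rewrite !coef_genus_poly => /andP[ij jk].
have [/andP[lo _]|] := ifP; last by rewrite eqxx.
have [/andP[_ hi]|] := ifP; last by rewrite eqxx.
rewrite ifT; last by rewrite (leq_trans lo)//= (leq_trans jk).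
rewrite /embeddings !cards_eq0 => /set0Pn[s /setIdP[sR /eqP sg]].
move=> /set0Pn[s' /setIdP[s'R /eqP s'g]].
have [|s'' s''R s''g] := @rotation_genus_between G s s' j sR s'R.
  by rewrite sg s'g ij.
by apply/set0Pn; exists s''; apply/setIdP; rewrite s''g.
Qed.

Local Close Scope ring_scope.

(** * Orbits and vertices of polygonal surfaces *)

Lemma flipK (T : Type) : involutive (@flip T).
Proof. by move=> [x b]; rewrite /flip/= negbK. Qed.

(** Rotating u to the front leaves [s2 ++ s1] behind it; the default [u] is the right successor in a
    one-letter word. *)
Lemma next_cat (T : eqType) (s1 s2 : seq T) (u : T) :
  uniq (s1 ++ u :: s2) -> next (s1 ++ u :: s2) u = seq.head u (s2 ++ s1).
Proof.
rewrite cat_uniq => /and3P[_ /norP[/= us1 _] _].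
rewrite next_nth mem_cat inE eqxx orbT.
case: s1 us1 => [|y s1] us1; first by rewrite /= eqxx cats0 -nth0.
rewrite [in index _ _]index_cat (negbTE us1) /= eqxx addn0 nth_cat.
by rewrite ltnNge leqnSn/= subSnn/=; case: s2.
Qed.

Lemma head_rcons (T : Type) (a u : T) (s : seq T) :
  seq.head a (s ++ [:: u]) = seq.head u s.
Proof. by case: s. Qed.

Section Orbits.
Variables (T : finType).

(** Counts the orbits that meet A, whereas [fcard] counts the roots lying in A; the two agree when A
    is stable under an injective f. *)
Definition orbit_count (f : T -> T) (A : {pred T}) := #|[set froot f z | z in A]|.

Lemma fcard_orbit_count (f : T -> T) (A : {pred T}) :
    injective f -> {homo f : z / z \in A} ->
  fcard f A = orbit_count f A.
Proof.
move=> finj Af; have sym := fconnect_sym finj; apply: eq_card => z.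
have Acl : fclosed f A.
  by apply: (intro_closed sym) => u v /= /eqP <-; exact: Af.
rewrite inE/=; apply/andP/imsetP => [[/eqP zr zA]|[u uA ->]].
  by exists z.
split; first exact: roots_root.
by rewrite -(closed_connect Acl (connect_root _ u)).
Qed.

Variables (f g : T -> T) (finj : injective f) (ginj : injective g).
Variables (A B : {pred T}) (Af : {homo f : z / z \in A}).
Variables (Bg : {homo g : z / z \in B}).

(* In the applications [g] is the first return map of [f] after some letters
   have been deleted, and [r] sends a deleted letter to the first remaining
   letter of its [f]-orbit. *)
Lemma orbit_count_retract (r h : T -> T) :
    (forall x, x \in B -> h x \in A /\ r (h x) = x) ->
    (forall z, z \in A -> r z \in B /\ fconnect f z (h (r z))) ->
    (forall z, z \in A ->
      r (f z) = r z \/ r (f z) = g (r z)) ->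
    (forall x, x \in B -> r (f (h x)) = g x) ->
  orbit_count f A = orbit_count g B.
Proof.
move=> hB rA step stepB.
have iterA z i : z \in A -> iter i f z \in A.
  by move=> zA; elim: i => //= i; exact: Af.
have fg z z' : z \in A -> fconnect f z z' -> fconnect g (r z) (r z').
  move=> zA /iter_findex <-; elim: (findex f z z') => //= i IH.
  have [->//|->] := step _ (iterA z i zA).
  by apply: connect_trans IH _; exact: fconnect1.
have gf x x' : x \in B -> fconnect g x x' -> fconnect f (h x) (h x').
  move=> xB /iter_findex <-; elim: (findex g x x') => //= i IH.
  apply: connect_trans IH _.
  have iB : iter i g x \in B by elim: i => //= i; exact: Bg.
  have [hA _] := hB _ iB; rewrite -(stepB _ iB).
  have [_ /(connect_trans _)] := rA _ (Af hA); apply; exact: fconnect1.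
have fE := root_connect (fconnect_sym finj).
have gE := root_connect (fconnect_sym ginj).
pose q z := froot g (r z).
have qE z z' : z \in A -> z' \in A -> (froot f z == froot f z') = (q z == q z').
  move=> zA z'A; rewrite fE gE; apply/idP/idP => [|c]; first exact: fg.
  have [rB zc] := rA _ zA; have [r'B z'c] := rA _ z'A.
  apply: connect_trans zc _; rewrite fconnect_sym//.
  by apply: connect_trans z'c _; rewrite fconnect_sym//; exact: gf.
have -> : orbit_count g B = #|[set q z | z in A]|.
  apply: eq_card => y; apply/imsetP/imsetP => [[x xB ->]|[z zA ->]].
    by have [hA rh] := hB _ xB; exists (h x); rewrite // /q rh.
  by exists (r z); rewrite //; have [] := rA _ zA.
(* The bijection from orbits of f to orbits of g, read on roots through any representative in A;
   [qE] gives both independence of the choice and injectivity. *)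
pose p y := if [pick z in A | froot f z == y] is Some z then q z else y.
have -> : [set q z | z in A] = p @: [set froot f z | z in A].
  rewrite -imset_comp; apply: eq_in_imset => z zA /=; rewrite /p.
  case: pickP => [z' /andP[z'A]|/(_ z)]; last by rewrite zA eqxx.
  by rewrite qE// => /eqP ->.
rewrite card_in_imset// => _ _ /imsetP[z zA ->] /imsetP[z' z'A ->].
rewrite /p; case: pickP => [u /andP[uA uz]|/(_ z)]; last by rewrite zA eqxx.
case: pickP => [u' /andP[u'A uz']|/(_ z')]; last by rewrite z'A eqxx.
by move/eqP; rewrite -qE// => /eqP; rewrite (eqP uz) (eqP uz').
Qed.

End Orbits.

Lemma orbit_count_orbit (T : finType) (f : T -> T) (A : {pred T}) (x : T) :
    injective f -> {homo f : z / z \in A} -> x \notin A ->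
  orbit_count f [predU fconnect f x & A] = (orbit_count f A).+1.
Proof.
move=> finj Af xA; have sym := fconnect_sym finj.
have Acl : fclosed f A.
  by apply: (intro_closed sym) => u v /= /eqP <-; exact: Af.
rewrite /orbit_count.
have -> : [set froot f z | z in [predU fconnect f x & A]] =
    froot f x |: [set froot f z | z in A].
  apply/setP => y; rewrite !inE; apply/imsetP/orP => [[z + ->]|].
    rewrite inE => /orP[xz|zA]; last by right; exact: imset_f.
    by left; rewrite (root_connect sym) sym.
  case=> [/eqP ->|/imsetP[z zA ->]]; first by exists x => //; apply/orP; left; exact: connect0.
  by exists z; rewrite // inE/= zA orbT.
rewrite cardsU1; case: imsetP => // -[z zA /eqP]; rewrite (root_connect sym) sym.
by move=> zx; case/negP: xA; rewrite -(closed_connect Acl zx).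
Qed.

(** The cycle [s] is a full orbit, that is, a vertex of the surface all of whose corners disappear
    with the deleted letters. *)
Lemma orbit_count_drop (T : finType) (f : T -> T) (A B : {pred T}) (s : seq T) (x : T) :
    injective f -> {homo f : z / z \in A} -> fcycle f s -> x \in s ->
    (forall z, z \in A = (z \in s) || (z \in B)) ->
    (forall z, z \in s -> z \notin B) ->
  {homo f : z / z \in B} /\ orbit_count f A = (orbit_count f B).+1.
Proof.
move=> finj Af fs xs AE sB.
have sym := fconnect_sym finj.
have conE z : fconnect f x z = (z \in s) by exact: fconnect_cycle.
have Bf : {homo f : z / z \in B}.
  move=> z zB; have : f z \in A by apply: Af; rewrite AE zB orbT.
  rewrite AE => /orP[|//]; rewrite -conE -(same_fconnect1_r finj) conE.
  by move=> /sB; rewrite zB.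
split=> //; rewrite -(orbit_count_orbit finj Bf (sB _ xs)).
rewrite /orbit_count; apply: eq_card => y.
by apply/imsetP/imsetP => -[z zA ->]; exists z => //; move: zA;
  rewrite AE -conE.
Qed.

Section WordSurfaces.
Variable n : nat.
Implicit Types (w C D E U W : seq (letter n)) (x y z : letter n).

Definition proper_word w := uniq w /\ {homo (@flip _) : z / z \in w}.

Lemma proper_perm w w' : perm_eq w w' -> proper_word w -> proper_word w'.
Proof.
move=> ww' [uw fw]; split; first by rewrite -(perm_uniq ww').
by move=> z; rewrite -!(perm_mem ww'); exact: fw.
Qed.

Lemma corner_next_inj w : uniq w -> injective (corner_next w).
Proof. by move=> uw y z /(can_inj (prev_next uw))/flip_inj. Qed.

Lemma corner_next_mem w :
  proper_word w -> {homo corner_next w : z / z \in w}.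
Proof. by move=> [_ fw] z zw; rewrite /corner_next mem_next fw. Qed.

(* The sphere is the surface of the empty word, which has no corner: the
   boolean supplies its missing vertex. *)
Definition vertices w : nat := (w == [::]) + fcard (corner_next w) (mem w).

(** V - E + F = 2 - 2g with F = 1, in additive form, so that no truncation can hide a failure. *)
Definition has_genus w (g : nat) := vertices w + g.*2 = 1 + (size w)./2.

Lemma has_genusE w g : has_genus w g -> word_genus w = g.
Proof.
rewrite /has_genus /vertices /word_genus; have [->/=|_] := eqVneq w [::].
  by rewrite -addnA => /eqP; rewrite eqn_add2l addn_eq0 => /andP[/eqP->]; case: g.
by rewrite add0n => <-; rewrite addKn doubleK.
Qed.

Lemma verticesE w :
  proper_word w -> vertices w = (w == [::]) + orbit_count (corner_next w) (mem w).
Proof.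
move=> pw; rewrite /vertices (fcard_orbit_count (corner_next_inj pw.1))//.
exact: corner_next_mem.
Qed.

Lemma has_genus_catC U W g :
  uniq (U ++ W) -> has_genus (U ++ W) g -> has_genus (W ++ U) g.
Proof.
have <- : rot (size U) (U ++ W) = W ++ U by exact: rot_size_cat.
move=> uw; rewrite /has_genus size_rot => <-; congr (_ + _).
rewrite /vertices; congr (_ + _); first by rewrite -!size_eq0 size_rot.
rewrite (@eq_fcard _ _ (corner_next (U ++ W))).
  by apply: eq_n_comp_r => z; exact: mem_rot.
by move=> z; rewrite /corner_next next_rot.
Qed.

End WordSurfaces.

(** * Removing a handle *)

Section Handle.
Variable n : nat.
Implicit Types (w C D E U W Q : seq (letter n)) (x y z : letter n).

Lemma next_split w U W x :
  uniq w -> w = U ++ x :: W -> next w x = seq.head x (W ++ U).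
Proof. by move=> uw wE; rewrite wE next_cat// -wE. Qed.

Lemma flip_neq x : flip x != x.
Proof. by case: x => a b; rewrite -pair_eqE /= /pair_eq/= eqb_negLR andbC; case: b. Qed.

Lemma proper_cat_perm w Q W :
    proper_word w -> perm_eq w (Q ++ W) -> {homo (@flip _) : z / z \in Q} ->
  proper_word W /\ (forall z, z \in Q -> z \notin W).
Proof.
move=> pw wQW fQ; have [uQW fQW] := proper_perm wQW pw.
move: (uQW); rewrite cat_uniq => /and3P[_ /hasPn QW uW].
have disj z : z \in Q -> z \notin W by apply: contraL => /QW.
split=> //; split=> // z zW; have := fQW z; rewrite !mem_cat zW orbT => /(_ isT).
by case/orP => // /fQ; rewrite flipK => /disj; rewrite zW.
Qed.

Lemma flip_closed_pair x : {homo (@flip _) : z / z \in [:: x; flip x]}.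
Proof.
by move=> z; rewrite !inE => /orP[]/eqP ->; rewrite ?flipK eqxx ?orbT.
Qed.

Lemma flip_closed_cat U W :
    {homo (@flip _) : z / z \in U} -> {homo (@flip _) : z / z \in W} ->
  {homo (@flip _) : z / z \in U ++ W}.
Proof.
by move=> fU fW z; rewrite !mem_cat => /orP[/fU|/fW] ->; rewrite ?orbT.
Qed.

Lemma split_mem (s : seq (letter n)) x :
  x \in s -> exists U W, s = U ++ x :: W.
Proof. by case/splitPr => U W; exists U, W. Qed.

Lemma head_neq_nil (a b : letter n) (s : seq (letter n)) :
  s != [::] -> seq.head a s = seq.head b s.
Proof. by case: s. Qed.

Lemma mem_head_neq_nil (a : letter n) (s : seq (letter n)) :
  s != [::] -> seq.head a s \in s.
Proof. by case: s => //= b s _; rewrite mem_head. Qed.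

(** No vertex is lost: skipping the four deleted letters, the corner permutation runs through the
    strings in the cyclic order D, C, E. Two edges go while the number of vertices stays, hence the
    genus drops by one. *)
Lemma vertices_handle x y C D E :
    proper_word (x :: y :: C ++ flip x :: D ++ flip y :: E) ->
    D ++ C ++ E != [::] ->
  vertices (x :: y :: C ++ flip x :: D ++ flip y :: E) = vertices (D ++ C ++ E).
Proof.
set w := x :: _; set W := D ++ _ => pw W0.
pose Q := [:: x; flip x] ++ [:: y; flip y].
have wQW : perm_eq w (Q ++ W).
  by apply/seq.permP => p; rewrite /w /Q /W /= !count_cat/= !count_cat/=; lia.
have fQ : {homo (@flip _) : z / z \in Q}.
  by apply: flip_closed_cat; exact: flip_closed_pair.
have [pW QW] := proper_cat_perm pw wQW fQ.
have [uw _] := pw; have [uW fW] := pW.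
have : uniq (Q ++ W) by rewrite -(perm_uniq wQW).
rewrite cat_uniq => /andP[+ _]; rewrite /Q/= !inE !negb_or => uQ.
have {uQ}[xy xy' fxy fxy'] : [/\ x != y, x != flip y, flip x != y & flip x != flip y].
  by case/and4P: uQ => /and3P[_ -> ->] /andP[-> ->].
(* From a deleted letter, the corner permutation enters E (after [y] or [flip x]), D (after [x]) or
   C (after [flip y]). If that string is empty, it continues with the next one in the cyclic
   order. *)
pose r z := if z \in [:: y; flip x] then seq.head z (E ++ D ++ C)
  else if z == x then seq.head z (D ++ C ++ E)
  else if z == flip y then seq.head z (C ++ E ++ D) else z.
have rW z : z \in W -> r z = z.
  move=> zW; rewrite /r !inE.
  by do !case: eqP => [zE|_]; rewrite ?orbT //; move: zW;
    rewrite zE (negbTE (QW _ _))// !inE eqxx ?orbT.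
have rx : r x = seq.head x (D ++ C ++ E).
  by rewrite /r !inE (negbTE xy) eq_sym (negbTE (flip_neq x)) eqxx.
have ry : r y = seq.head y (E ++ D ++ C) by rewrite /r !inE eqxx.
have rx' : r (flip x) = seq.head (flip x) (E ++ D ++ C).
  by rewrite /r !inE eqxx orbT.
have ry' : r (flip y) = seq.head (flip y) (C ++ E ++ D).
  rewrite /r !inE (negbTE (flip_neq y)) eq_sym (negbTE fxy') eq_sym.
  by rewrite (negbTE xy') eqxx.
pose f := corner_next w; pose g := corner_next W.
have fx : f x = seq.head (flip x) (D ++ flip y :: E ++ x :: y :: C).
  rewrite /f /corner_next (@next_split _ (x :: y :: C) (D ++ flip y :: E))//.
  by rewrite -catA.
have fx' : f (flip x) = y by rewrite /f /corner_next flipK /w/= eqxx.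
have fy : f y = seq.head (flip y) (E ++ x :: y :: C ++ flip x :: D).
  rewrite /f /corner_next (@next_split _ (x :: y :: C ++ flip x :: D) E)//.
  by rewrite /w/= -!catA.
have fy' : f (flip y) = seq.head y (C ++ flip x :: D ++ flip y :: E ++ [:: x]).
  rewrite /f /corner_next flipK.
  rewrite (@next_split _ [:: x] (C ++ flip x :: D ++ flip y :: E))//.
  by rewrite -!catA/= -!catA.
have wE z : z \in w = (z \in Q) || (z \in W) by rewrite (perm_mem wQW) mem_cat.
have Wsub z : z \in W -> z \in w by rewrite wE => ->; rewrite orbT.
(* The only case with content is a letter at the end of C, D or E: its successor in w is deleted,
   and [r] leads to its successor in W. *)
have kept z : z \in W -> r (f z) = g z.
  move=> /fW; rewrite /f /g /corner_next; move: (flip z) => u uW'.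
  move: (uW'); rewrite /W !mem_cat => /or3P[] /split_mem[U1 [U2 UE]].
  - rewrite (@next_split w (x :: y :: C ++ flip x :: U1)
      (U2 ++ flip y :: E)) ?(@next_split W U1 (U2 ++ C ++ E))//.
    + case: U2 UE => [|v U2] UE; last first.
        by rewrite /= rW// /W UE !mem_cat !inE eqxx !orbT.
      by rewrite /= ry' UE !catA head_rcons.
    + by rewrite /W UE -!catA.
    + by rewrite /w UE/= -!catA/= -?catA.
  - rewrite (@next_split w (x :: y :: U1)
      (U2 ++ flip x :: D ++ flip y :: E)) ?(@next_split W (D ++ U1) (U2 ++ E))//.
    + case: U2 UE => [|v U2] UE; last first.
        by rewrite /= rW// /W UE !mem_cat !inE eqxx !orbT.
      by rewrite /= rx' UE !catA head_rcons.
    + by rewrite /W UE -!catA.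
    + by rewrite /w UE/= -!catA/= -?catA.
  - rewrite (@next_split w (x :: y :: C ++ flip x :: D ++ flip y :: U1) U2)
      ?(@next_split W (D ++ C ++ U1) U2)//.
    + case: U2 UE => [|v U2] UE; last first.
        by rewrite /= rW// /W UE !mem_cat !inE eqxx !orbT.
      by rewrite /= rx UE !catA head_rcons.
    + by rewrite /W UE -!catA.
    + by rewrite /w UE/= -!catA/= -?catA.
have W1 : E ++ D ++ C != [::].
  by move: W0; rewrite /W -!size_eq0 !size_cat !addn_eq0; do 3![case: eqP].
have W2 : C ++ E ++ D != [::].
  by move: W0; rewrite /W -!size_eq0 !size_cat !addn_eq0; do 3![case: eqP].
have removed z : z \in Q -> r (f z) = r z.
  rewrite /Q !inE => /or4P[] /eqP ->.
  - rewrite fx rx; case DE: D => [|v D'] /=.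
      by rewrite ry' DE cats0; apply: head_neq_nil; rewrite /W DE in W0.
    by rewrite rW// /W DE !inE eqxx.
  - by rewrite fx' ry rx'; apply: head_neq_nil.
  - rewrite fy ry; case EE: E => [|v E'] /=.
      by rewrite rx EE cats0; apply: head_neq_nil; rewrite EE in W1.
    by rewrite rW// /W EE !mem_cat !inE eqxx !orbT.
  - rewrite fy' ry'; case CE: C => [|v C'] /=.
      by rewrite rx' CE cats0; apply: head_neq_nil; rewrite CE in W2.
    by rewrite rW// /W CE !mem_cat !inE eqxx !orbT.
have rQ z : z \in Q -> r z \in W.
  have E1 : E ++ D ++ C =i W by move=> u; rewrite /W !mem_cat; do !case: (_ \in _).
  have E2 : C ++ E ++ D =i W by move=> u; rewrite /W !mem_cat; do !case: (_ \in _).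
  rewrite /Q !inE => /or4P[] /eqP ->.
  - by rewrite rx mem_head_neq_nil.
  - by rewrite rx' -E1 mem_head_neq_nil.
  - by rewrite ry -E1 mem_head_neq_nil.
  - by rewrite ry' -E2 mem_head_neq_nil.
(* The deleted letters follow one another along x, y^-, x^-, y, and this closes into a cycle only
   when C, D and E are all empty. Otherwise some deleted letter leads directly to a kept one, and
   the others are reached backwards from it. *)
have con z : z \in Q -> fconnect f z (r z).
  have via u : fconnect f (f u) (r (f u)) -> u \in Q -> fconnect f u (r u).
    move=> fu uQ; rewrite -removed//; apply: connect_trans fu.
    exact: fconnect1.
  have direct u : f u \in W -> u \in Q -> fconnect f u (r u).
    by move=> fu; apply: via; rewrite rW// connect0.
  have [xQ x'Q yQ y'Q] : [/\ x \in Q, flip x \in Q, y \in Q & flip y \in Q].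
    by rewrite /Q !inE !eqxx !orbT.
  suff : [/\ fconnect f x (r x), fconnect f (flip x) (r (flip x)),
      fconnect f y (r y) & fconnect f (flip y) (r (flip y))].
    by case=> ? ? ? ?; rewrite /Q !inE => /or4P[] /eqP ->.
  case DE: D => [|v D'].
    have fxE : f x = flip y by rewrite fx DE.
    case CE: C => [|v C'].
      have fyE' : f (flip y) = flip x by rewrite fy' CE.
      case EE: E => [|v E']; first by move: W0; rewrite /W DE CE EE.
      have cy : fconnect f y (r y).
        by apply: direct => //; rewrite fy EE /W !mem_cat EE mem_head !orbT.
      have cx' : fconnect f (flip x) (r (flip x)) by apply: via => //; rewrite fx'.
      have cy' : fconnect f (flip y) (r (flip y)) by apply: via => //; rewrite fyE'.
      by split=> //; apply: via => //; rewrite fxE.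
    have cy' : fconnect f (flip y) (r (flip y)).
      by apply: direct => //; rewrite fy' CE /W !mem_cat CE mem_head !orbT.
    have cx : fconnect f x (r x) by apply: via => //; rewrite fxE.
    have cy : fconnect f y (r y).
      case EE: E => [|u E']; first by apply: via => //; rewrite fy EE.
      by apply: direct => //; rewrite fy EE /W !mem_cat EE mem_head !orbT.
    by split=> //; apply: via => //; rewrite fx'.
  have cx : fconnect f x (r x).
    by apply: direct => //; rewrite fx DE /W !mem_cat DE mem_head.
  have cy : fconnect f y (r y).
    case EE: E => [|u E']; first by apply: via => //; rewrite fy EE.
    by apply: direct => //; rewrite fy EE /W !mem_cat EE mem_head !orbT.
  have cx' : fconnect f (flip x) (r (flip x)) by apply: via => //; rewrite fx'.
  split=> //; case CE: C => [|u C']; first by apply: via => //; rewrite fy' CE.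
  by apply: direct => //; rewrite fy' CE /W !mem_cat CE mem_head !orbT.
rewrite !verticesE// (negbTE W0) /=.
apply: (orbit_count_retract (corner_next_inj uw) (corner_next_inj uW)
  (corner_next_mem pw) (corner_next_mem pW) (r := r) (h := id)).
- by move=> z zW; rewrite rW//; split=> //; exact: Wsub.
- move=> z; rewrite wE => /orP[zQ|zW]; first by split; [exact: rQ|exact: con].
  by rewrite rW//; split=> //; exact: connect0.
- move=> z; rewrite wE => /orP[zQ|zW]; first by left; exact: removed.
  by right; rewrite (rW z)//; exact: kept.
- exact: kept.
Qed.

Lemma vertices_handle_nil x y :
  proper_word [:: x; y; flip x; flip y] -> vertices [:: x; y; flip x; flip y] = 1.
Proof.
set w := [:: x; _; _; _] => pw; have [uw _] := pw.
rewrite verticesE// add0n /orbit_count.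
pose f := corner_next w.
have fx : f x = flip y by rewrite /f /corner_next (@next_split w [:: x; y] [:: flip y]).
have fx' : f (flip x) = y.
  by rewrite /f /corner_next flipK (@next_split w [::] [:: y; flip x; flip y]).
have fy : f y = x by rewrite /f /corner_next (@next_split w [:: x; y; flip x] [::]).
have fy' : f (flip y) = flip x.
  by rewrite /f /corner_next flipK (@next_split w [:: x] [:: flip x; flip y]).
have con z : z \in w -> fconnect f x z.
  have c1 : fconnect f x (flip y) by rewrite -fx fconnect1.
  have c2 : fconnect f x (flip x).
    by apply: connect_trans c1 _; rewrite -fy' fconnect1.
  have c3 : fconnect f x y by apply: connect_trans c2 _; rewrite -fx' fconnect1.
  by rewrite !inE => /or4P[] /eqP ->//; exact: connect0.
have -> : [set froot (corner_next w) z | z in mem w] = [set froot f x].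
  apply/setP => u; rewrite inE; apply/imsetP/eqP => [[z zw ->]|->]; last first.
    by exists x; rewrite ?inE ?eqxx.
  apply/eqP; rewrite (root_connect (fconnect_sym (corner_next_inj uw))).
  by rewrite (fconnect_sym (corner_next_inj uw)); exact: con.
by rewrite cards1.
Qed.

Lemma has_genus_handle x y C D E g :
    proper_word (x :: y :: C ++ flip x :: D ++ flip y :: E) ->
    has_genus (D ++ C ++ E) g ->
  has_genus (x :: y :: C ++ flip x :: D ++ flip y :: E) g.+1.
Proof.
move=> pw; rewrite /has_genus => HW.
have -> : size (x :: y :: C ++ flip x :: D ++ flip y :: E) =
    (size (D ++ C ++ E)).+4.
  by rewrite /= !size_cat/= size_cat/=; lia.
have -> : vertices (x :: y :: C ++ flip x :: D ++ flip y :: E) =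
    vertices (D ++ C ++ E).
  (* With no letter left the surface is a sphere, whose single vertex comes from the boolean in
     [vertices]; the torus word has one vertex too. *)
  have [W0|] := eqVneq (D ++ C ++ E) [::]; last exact: vertices_handle.
  move: pw W0; case: D {HW} => //; case: C => //; case: E => //= pw _.
  rewrite vertices_handle_nil// /vertices eqxx; apply/esym/eqP.
  by rewrite eqSS; apply/eqP/eq_card0 => z; rewrite !inE andbF.
by rewrite doubleS !addnS HW.
Qed.

End Handle.

(** * Cancelling a pair and merging parallel sides *)

Section CancelMerge.
Variable n : nat.
Implicit Types (w C D E U W Q : seq (letter n)) (x y z : letter n).

(** The corner at [flip x] is a vertex by itself, the tip of the fold, and disappears; the corner at
    [x] is absorbed into the orbit of the first letter of W. *)
Lemma vertices_cancel x W :
    proper_word (x :: flip x :: W) -> W != [::] ->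
  vertices (x :: flip x :: W) = (vertices W).+1.
Proof.
set w := x :: _ => pw W0; have [uw _] := pw.
have [pW QW] := @proper_cat_perm n w [:: x; flip x] W pw (perm_refl _)
  (@flip_closed_pair _ x).
have [uW fW] := pW; pose f := corner_next w; pose g := corner_next W.
have xW : x \notin W by apply: QW; rewrite inE eqxx.
have x'W : flip x \notin W by apply: QW; rewrite !inE eqxx orbT.
have fx : f x = seq.head (flip x) (W ++ [:: x]).
  by rewrite /f /corner_next (@next_split _ w [:: x] W).
have fx' : f (flip x) = flip x by rewrite /f /corner_next flipK /w/= eqxx.
have [||||Bf BE] := @orbit_count_drop _ f (mem w) (mem (x :: W)) [:: flip x]
  (flip x) (corner_next_inj uw) (corner_next_mem pw).
- by rewrite /= fx' eqxx.
- exact: mem_head.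
- by move=> z; rewrite !inE orbCA.
- by move=> z; rewrite !inE => /eqP ->; rewrite negb_or flip_neq x'W.
rewrite !verticesE// (negbTE W0) !add0n BE; congr _.+1.
pose r z := if z == x then seq.head z W else z.
have rW z : z \in W -> r z = z.
  by move=> zW; rewrite /r; case: eqP => // zx; rewrite -zx zW in xW.
have rx : r x = seq.head x W by rewrite /r eqxx.
have rfx : r (f x) = r x.
  rewrite fx rx; case WE: W W0 => [|v W']// _ /=.
  by rewrite rW// WE mem_head.
have kept z : z \in W -> r (f z) = g z.
  move=> /fW; rewrite /f /g /corner_next; move: (flip z) => u uW'.
  have [U1 [U2 UE]] := split_mem uW'.
  rewrite (@next_split _ w (x :: flip x :: U1) U2) ?(@next_split _ W U1 U2)//.
    case: U2 UE => [|v U2] UE.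
      by rewrite /= rx UE; case: (U1).
    by rewrite /= rW// UE mem_cat !inE eqxx !orbT.
  by rewrite /w UE.
apply: (orbit_count_retract (corner_next_inj uw) (corner_next_inj uW)
  Bf (corner_next_mem pW) (r := r) (h := id)).
- by move=> z zW; rewrite rW//; split=> //; apply/orP; right.
- move=> z; rewrite inE => /predU1P[->|zW].
    rewrite rx mem_head_neq_nil//; split=> //.
    have -> : seq.head x W = f x by rewrite fx; case: (W) W0.
    exact: fconnect1.
  by rewrite rW//; split=> //; exact: connect0.
- move=> z; rewrite inE => /predU1P[->|zW]; first by left.
  by right; rewrite (rW z)//; exact: kept.
- exact: kept.
Qed.

Lemma vertices_cancel_nil x :
  proper_word [:: x; flip x] -> vertices [:: x; flip x] = 2.
Proof.
set w := [:: x; _] => pw; have [uw _] := pw.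
pose f := corner_next w.
have fx : f x = x by rewrite /f /corner_next (@next_split _ w [:: x] [::]).
have fx' : f (flip x) = flip x by rewrite /f /corner_next flipK /w/= eqxx.
have [||||Bf BE] := @orbit_count_drop _ f (mem w) (mem [:: x]) [:: flip x]
  (flip x) (corner_next_inj uw) (corner_next_mem pw).
- by rewrite /= fx' eqxx.
- exact: mem_head.
- by move=> z; rewrite !inE orbC.
- by move=> z; rewrite !inE => /eqP ->; rewrite flip_neq.
have [||||_ CE] := @orbit_count_drop _ f (mem [:: x]) pred0 [:: x]
  x (corner_next_inj uw) Bf.
- by rewrite /= fx eqxx.
- exact: mem_head.
- by move=> z; rewrite !inE orbF.
- by [].
rewrite verticesE// add0n BE CE; congr _.+2; apply: eq_card0 => y.
by apply/imsetP => -[].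
Qed.

Lemma has_genus_cancel x W g :
  proper_word (x :: flip x :: W) -> has_genus W g ->
  has_genus (x :: flip x :: W) g.
Proof.
move=> pw; rewrite /has_genus => HW.
have -> : vertices (x :: flip x :: W) = (vertices W).+1.
  have [W0|] := eqVneq W [::]; last exact: vertices_cancel.
  rewrite W0 vertices_cancel_nil -?W0// W0 /vertices eqxx; apply/esym/eqP.
  by rewrite !eqSS; apply/eqP/eq_card0 => z; rewrite !inE andbF.
by rewrite addSn HW.
Qed.

Lemma has_genus_cancel_mid x U W g :
  proper_word (U ++ x :: flip x :: W) -> has_genus (U ++ W) g ->
  has_genus (U ++ x :: flip x :: W) g.
Proof.
move=> pw HUW; have rot_w : perm_eq (U ++ x :: flip x :: W) (x :: flip x :: W ++ U).
  by rewrite perm_catC.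
have pw' := proper_perm rot_w pw.
apply: (@has_genus_catC _ (x :: flip x :: W) U); first by have [] := pw'.
apply: has_genus_cancel => //; apply: has_genus_catC => //.
by have [] := pw; rewrite !cat_uniq/= => /and3P[-> /norP[_ /norP[_ ->]] /and3P[_ _ ->]].
Qed.

(** The sides x and y run in parallel and fuse into one. The vertex between them has exactly the
    corners [y] and [flip x], and disappears. *)
Lemma vertices_merge x y U W :
    proper_word (x :: y :: U ++ flip y :: flip x :: W) ->
  vertices (x :: y :: U ++ flip y :: flip x :: W) =
  (vertices (x :: U ++ flip x :: W)).+1.
Proof.
set w := x :: _; set w' := x :: (_ ++ _) => pw; have [uw _] := pw.
have wQW : perm_eq w ([:: y; flip y] ++ w').
  by apply/seq.permP => p; rewrite /w /w' /= !count_cat/=; lia.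
have [pw' QW] := proper_cat_perm pw wQW (@flip_closed_pair _ y).
have wQW' : perm_eq w ([:: x; flip x] ++ ([:: y; flip y] ++ (U ++ W))).
  by apply/seq.permP => p; rewrite /w /= !count_cat/=; lia.
have [uw' fw'] := pw'.
have [pyUW xyUW] := proper_cat_perm pw wQW' (@flip_closed_pair _ x).
have [[_ fUW] yUW] := proper_cat_perm pyUW (perm_refl _) (@flip_closed_pair _ y).
pose f := corner_next w; pose g := corner_next w'.
have xNUW : x \notin [:: y, flip y & U ++ W] by apply: xyUW; exact: mem_head.
have x'NUW : flip x \notin [:: y, flip y & U ++ W].
  by apply: xyUW; rewrite !inE eqxx orbT.
have yNUW : y \notin U ++ W by apply: yUW; exact: mem_head.
have y'NUW : flip y \notin U ++ W by apply: yUW; rewrite !inE eqxx orbT.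
have fx : f x = seq.head (flip x) (W ++ x :: y :: U ++ [:: flip y]).
  rewrite /f /corner_next (@next_split _ w (x :: y :: U ++ [:: flip y]) W)//.
  by rewrite /w/= -catA.
have fx' : f (flip x) = y by rewrite /f /corner_next flipK /w/= eqxx.
have fy : f y = flip x.
  by rewrite /f /corner_next (@next_split _ w (x :: y :: U) (flip x :: W)).
have fy' : f (flip y) = seq.head y (U ++ flip y :: flip x :: W ++ [:: x]).
  rewrite /f /corner_next flipK.
  by rewrite (@next_split _ w [:: x] (U ++ flip y :: flip x :: W))//= -catA.
have gx : g x = seq.head (flip x) (W ++ x :: U).
  by rewrite /g /corner_next (@next_split _ w' (x :: U) W).
have gx' : g (flip x) = seq.head x (U ++ flip x :: W).
  rewrite /g /corner_next flipK (@next_split _ w' [::] (U ++ flip x :: W))//.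
  by rewrite cats0.
have [||||Bf BE] := @orbit_count_drop _ f (mem w)
  (mem (x :: flip y :: U ++ W)) [:: y; flip x] y
  (corner_next_inj uw) (corner_next_mem pw).
- by rewrite /= fx' fy !eqxx.
- exact: mem_head.
- by move=> z; rewrite (perm_mem wQW') !inE; do !case: (_ == _) => //=.
- move=> z; rewrite !inE => /orP[] /eqP ->; rewrite !negb_or.
    rewrite (eq_sym y (flip y)) flip_neq yNUW !andbT eq_sym.
    by move: xNUW; rewrite inE negb_or => /andP[].
  rewrite flip_neq /=.
  by move: x'NUW; rewrite !inE !negb_or => /and3P[_ -> ->].
rewrite !verticesE// !add0n BE; congr _.+1.
(* Once [y] and [flip x] are gone, the corner at [flip y] plays the part of [flip x] in the shorter
   word. *)
pose r z := if z == flip y then flip x else z.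
pose h z := if z == flip x then flip y else z.
have rUW z : z \in x :: U ++ W -> r z = z.
  rewrite /r; case: eqP => // ->; rewrite inE => /predU1P[yx|].
    by move: xNUW; rewrite -yx !inE eqxx orbT.
  by rewrite (negbTE y'NUW).
have hUW z : z \in x :: U ++ W -> h z = z.
  rewrite /h; case: eqP => // ->; rewrite inE => /predU1P[/eqP|].
    by rewrite (negbTE (flip_neq x)).
  by move: x'NUW; rewrite !inE !negb_or => /and3P[_ _ /negbTE ->].
have ry' : r (flip y) = flip x by rewrite /r eqxx.
have hx' : h (flip x) = flip y by rewrite /h eqxx.
have kept z : z \in x :: flip y :: U ++ W -> r (f z) = g (r z).
  rewrite inE => /predU1P[->|].
    rewrite (rUW x) ?mem_head// fx gx; case WE: W => [|v W'] /=.
      by rewrite rUW ?mem_head.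
    by rewrite rUW// WE !inE mem_cat mem_head !orbT.
  rewrite inE => /predU1P[->|zUW].
    rewrite ry' fy' gx'; case UE: U => [|v U'] //=.
    by rewrite rUW// UE !inE/= eqxx !orbT.
  rewrite (rUW z) ?inE ?zUW ?orbT//.
  move/fUW: zUW; rewrite /f /g /corner_next; move: (flip z) => u.
  rewrite mem_cat => /orP[] /split_mem[U1 [U2 UE]].
  - rewrite (@next_split _ w (x :: y :: U1) (U2 ++ flip y :: flip x :: W))
      ?(@next_split _ w' (x :: U1) (U2 ++ flip x :: W))//.
    + case: U2 UE => [|v U2] UE //=.
      by rewrite rUW// UE !inE !mem_cat !inE eqxx !orbT.
    + by rewrite /w' UE/= -catA.
    + by rewrite /w UE/= -catA.
  - rewrite (@next_split _ w (x :: y :: U ++ flip y :: flip x :: U1) U2)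
      ?(@next_split _ w' (x :: U ++ flip x :: U1) U2)//.
    + case: U2 UE => [|v U2] UE /=; first by rewrite rUW ?mem_head.
      by rewrite rUW// UE !inE !mem_cat !inE eqxx !orbT.
    + by rewrite /w' UE/= -catA.
    + by rewrite /w UE/= -catA.
have w'E z : z \in w' = (z == flip x) || (z \in x :: U ++ W).
  by rewrite /w' !inE !mem_cat !inE; do !case: (_ == _) => //=; rewrite ?orbT.
have BE' z : z \in x :: flip y :: U ++ W = (z == flip y) || (z \in x :: U ++ W).
  by rewrite !inE orbCA.
apply: (orbit_count_retract (corner_next_inj uw) (corner_next_inj uw')
  Bf (corner_next_mem pw') (r := r) (h := h)).
- move=> z; rewrite w'E => /predU1P[->|zUW].
    by rewrite hx' ry' !inE eqxx orbT.
  by rewrite hUW// rUW//; split=> //; apply: etrans (BE' z) _; rewrite zUW orbT.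
- move=> z /(etrans (esym (BE' z))) /predU1P[->|zUW].
    by rewrite ry' hx' w'E eqxx; split=> //; exact: connect0.
  by rewrite rUW// hUW// w'E zUW orbT; split=> //; exact: connect0.
- by move=> z zB; right; exact: kept.
- move=> z; rewrite w'E => /predU1P[->|zUW].
    by rewrite hx' kept ?ry'// !inE eqxx orbT.
  by rewrite hUW// kept ?(rUW z)// BE' zUW orbT.
Qed.

Lemma has_genus_merge x y U W g :
    proper_word (x :: y :: U ++ flip y :: flip x :: W) ->
    has_genus (x :: U ++ flip x :: W) g ->
  has_genus (x :: y :: U ++ flip y :: flip x :: W) g.
Proof.
move=> pw HW; rewrite /has_genus vertices_merge// addSn HW.
by rewrite /= !size_cat/= !addnS.
Qed.

End CancelMerge.

(** * Ladder surfaces *)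

Section Families.
Variable n : nat.
Implicit Types (x : 'I_n) (y z : letter n) (U W : seq (letter n)) (l : seq 'I_n) (K T : {set 'I_n}).

(* The sequences [l] list the indices from the outermost (largest) one
   inwards, so that R_1, R_2, R_3 and R_4 are [desc false l K],
   [asc false l K], [desc true l T] and [asc true l T]. *)
Definition lit x (s : bool) : letter n := (Some x, s).

Definition desc (s : bool) l K : seq (letter n) :=
  [seq lit x s | x <- l & x \in K].
Definition asc (s : bool) l K : seq (letter n) :=
  rev [seq lit x s | x <- l & x \notin K].

(** [vword] is the shape of S_1, and [crossed_word] that of S_6 with y as the letter a.
    [barred_vword] appears when the outermost letter of a [vword] surrounds one half of it,
    [lambda_word] (up to rotation) when a handle is removed from a [crossed_word]. *)
Definition vword l K T :=
  desc false l K ++ asc false l K ++ desc true l T ++ asc true l T.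
Definition barred_vword y l K T :=
  y :: desc false l K ++ asc false l K ++ flip y :: desc true l T ++ asc true l T.
Definition crossed_word y l K T :=
  y :: desc false l K ++ asc true l T ++ flip y :: asc false l K ++ desc true l T.
Definition lambda_word l K T :=
  desc false l K ++ asc true l T ++ desc true l T ++ asc false l K.

Lemma desc_cons s x l K :
  desc s (x :: l) K = if x \in K then lit x s :: desc s l K else desc s l K.
Proof. by rewrite /desc /=; case: ifP. Qed.

Lemma asc_cons s x l K :
  asc s (x :: l) K = if x \in K then asc s l K else asc s l K ++ [:: lit x s].
Proof. by rewrite /asc /=; case: (x \in K) => //=; rewrite rev_cons -cats1. Qed.

Lemma eq_desc s l K K' : {in l, K =i K'} -> desc s l K = desc s l K'.
Proof. by move=> KK'; congr map; apply: eq_in_filter => x /KK' ->. Qed.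

Lemma eq_asc s l K K' : {in l, K =i K'} -> asc s l K = asc s l K'.
Proof. by move=> KK'; congr (rev (map _ _)); apply: eq_in_filter => x /KK' ->. Qed.

Lemma count_desc_asc (p : pred (letter n)) s l K :
  count p (desc s l K) + count p (asc s l K) = count p [seq lit x s | x <- l].
Proof.
rewrite count_rev -count_cat -map_cat; apply/seq.permP/perm_map.
by rewrite perm_filterC.
Qed.

Definition letters_of l : seq (letter n) :=
  [seq lit x false | x <- l] ++ [seq lit x true | x <- l].

Lemma mem_letters_of l y : (y \in letters_of l) = (y.1 \in map Some l).
Proof.
rewrite mem_cat; apply/orP/mapP => [[] /mapP[x xl ->]|[x xl]]; try by exists x.
by case: y => y [] /= ->; [right|left]; apply: map_f.
Qed.

Lemma proper_letters_of l : uniq l -> proper_word (letters_of l).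
Proof.
move=> ul; split; last by move=> y; rewrite !mem_letters_of.
rewrite cat_uniq !map_inj_uniq ?ul /= ?andbT; try by move=> ? ? [].
by apply/hasPn => _ /mapP[x _ ->]; apply/mapP => -[].
Qed.

Lemma proper_vword w l K T : uniq l -> perm_eq (vword l K T) w -> proper_word w.
Proof.
move=> ul lw; apply: proper_perm lw (proper_perm _ (proper_letters_of ul)).
apply/seq.permP => p; rewrite /vword /letters_of !count_cat.
by rewrite -(count_desc_asc p false l K) -(count_desc_asc p true l T) !addnA.
Qed.

Lemma proper_barred_vword w y l K T :
    uniq l -> y.1 \notin map Some l -> perm_eq (barred_vword y l K T) w ->
  proper_word w.
Proof.
move=> ul yl yw; apply: proper_perm yw (@proper_perm _ (y :: flip y :: letters_of l) _ _ _).
  apply/seq.permP => p; rewrite /letters_of /= !count_cat/= !count_cat.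
  rewrite -(count_desc_asc p false l K) -(count_desc_asc p true l T).
  move: (count p (desc false l K)) (count p (asc false l K)).
  move: (count p (desc true l T)) (count p (asc true l T)) => a b c d; lia.
have [u f] := proper_letters_of ul.
split.
  rewrite /= inE negb_or !mem_letters_of u andbT eq_sym flip_neq /=.
  by apply/andP; split; exact: yl.
move=> z; rewrite !inE => /or3P[/eqP ->|/eqP ->|/f ->].
- by rewrite eqxx orbT.
- by rewrite flipK eqxx.
by rewrite !orbT.
Qed.

Lemma proper_crossed_word w y l K T :
    uniq l -> y.1 \notin map Some l -> perm_eq (crossed_word y l K T) w ->
  proper_word w.
Proof.
move=> ul yl yw; have := proper_barred_vword ul yl (perm_refl (barred_vword y l K T)).
apply: (proper_perm yw \o proper_perm _).
  apply/seq.permP => p.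
  rewrite /barred_vword /crossed_word /= !count_cat/= !count_cat.
  move: (count p (desc false l K)) (count p (asc false l K)).
  move: (count p (desc true l T)) (count p (asc true l T)) => a b c d; lia.
Qed.

Lemma has_genus_rot U W g :
  proper_word (U ++ W) -> has_genus (W ++ U) g -> has_genus (U ++ W) g.
Proof.
by move=> [uUW _]; apply: has_genus_catC; rewrite uniq_catC.
Qed.

Lemma has_genus_cancel_ends y W g :
  proper_word (y :: W ++ [:: flip y]) -> has_genus W g ->
  has_genus (y :: W ++ [:: flip y]) g.
Proof.
move=> pw HW; apply: (@has_genus_rot (y :: W) [:: flip y]) => //=.
have E : flip y :: y :: W = flip y :: flip (flip y) :: W by rewrite flipK.
rewrite E; apply: has_genus_cancel => //; rewrite -E.
by apply: proper_perm pw; rewrite -cat_cons perm_catC.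
Qed.

Lemma has_genus_handle_eq (x y x' y' : letter n) C D E g : x' = flip x -> y' = flip y ->
    proper_word (x :: y :: C ++ x' :: D ++ y' :: E) ->
    has_genus (D ++ C ++ E) g ->
  has_genus (x :: y :: C ++ x' :: D ++ y' :: E) g.+1.
Proof. by move=> -> ->; exact: has_genus_handle. Qed.

Lemma has_genus_vword_cons x l K T g : uniq (x :: l) ->
    has_genus (
      if x \in K then
        if x \in T then barred_vword (lit x false) l K T else vword l K T
      else
        if x \in T then vword l K T else barred_vword (lit x true) l K T) g ->
  has_genus (vword (x :: l) K T) g.
Proof.
move=> ul; have := proper_vword ul (perm_refl (vword (x :: l) K T)).
rewrite /vword /barred_vword !desc_cons !asc_cons.
move: (desc _ _ _) (asc _ _ _) (desc _ _ _) (asc _ _ _) => c d a b.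
case: (x \in K); case: (x \in T); lazy iota; rewrite ?cat_cons.
- by [].
- have -> : a ++ b ++ c ++ d ++ [:: lit x true] =
      (a ++ b ++ c ++ d) ++ [:: lit x true] by rewrite -!catA.
  exact: has_genus_cancel_ends.
- by rewrite -catA cat1s catA => pw H; apply: has_genus_cancel_mid; rewrite // -catA.
have -> : a ++ (b ++ [:: lit x false]) ++ c ++ d ++ [:: lit x true] =
    (a ++ b ++ lit x false :: c ++ d) ++ [:: lit x true].
  by rewrite -!catA cat1s cat_cons -!catA.
by move=> pw H; apply: has_genus_rot.
Qed.

(** Whatever its position, x lies in one half and its inverse in the other, so x and y always
    interleave and form a handle. *)
Lemma has_genus_barred_vword_cons x y l K T g :
    uniq (x :: l) -> y.1 \notin map Some (x :: l) ->
    has_genus (vword l K T) g ->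
  has_genus (barred_vword y (x :: l) K T) g.+1.
Proof.
move=> ul yl;
  have := proper_barred_vword ul yl (perm_refl (barred_vword y (x :: l) K T)).
have [_ /proper_vword/(_ (perm_refl (vword l K T)))] := andP ul.
rewrite /vword /barred_vword !desc_cons !asc_cons.
move: (desc _ _ _) (asc _ _ _) (desc _ _ _) (asc _ _ _) => c d a b pl.
case: (x \in K); case: (x \in T); lazy iota; rewrite ?cat_cons => pw H.
(* In two of the four cases the removed handle leaves the two halves exchanged. *)
all: have HR : has_genus ((c ++ d) ++ a ++ b) g
  by apply: has_genus_catC; rewrite -catA //; case: pl.
- rewrite [a ++ _]catA in pw *.
  apply: (@has_genus_handle_eq y (lit x false) _ _ (a ++ b) [::] (c ++ d)) => //.
  by rewrite -catA.
- have E : y :: lit x false :: a ++ b ++ flip y :: c ++ d ++ [:: lit x true] =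
      (y :: lit x false :: (a ++ b) ++ flip y :: (c ++ d)) ++ [:: lit x true].
    by rewrite !cat_cons -!catA cat_cons -!catA.
  rewrite E in pw *; apply: has_genus_rot => //.
  apply: (@has_genus_handle_eq (lit x true) y _ _ [::] (a ++ b) (c ++ d)) => //.
    by apply: proper_perm pw; rewrite perm_catC.
  by rewrite -catA.
- have E : y :: a ++ (b ++ [:: lit x false]) ++ flip y :: lit x true :: c ++ d =
      (y :: a ++ b) ++ (lit x false :: flip y :: lit x true :: c ++ d).
    by rewrite !cat_cons -!catA cat1s.
  rewrite E in pw *; apply: has_genus_rot => //.
  apply: (@has_genus_handle_eq (lit x false) (flip y) _ _ [::] (c ++ d) (a ++ b));
    rewrite ?flipK //.
  by apply: proper_perm pw; rewrite perm_catC.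
have E : y :: a ++ (b ++ [:: lit x false]) ++ flip y :: c ++ d ++ [:: lit x true] =
    (y :: a ++ b) ++ (lit x false :: flip y :: (c ++ d) ++ [:: lit x true]).
  by rewrite !cat_cons -!catA cat1s.
rewrite E in pw *; apply: has_genus_rot => //.
have E' : (lit x false :: flip y :: (c ++ d) ++ [:: lit x true]) ++ y :: a ++ b =
   lit x false :: flip y :: (c ++ d) ++ lit x true :: [::] ++ y :: a ++ b.
  by rewrite !cat_cons -!catA cat1s.
rewrite E'; apply: has_genus_handle_eq; rewrite ?flipK //.
by rewrite -E'; apply: proper_perm pw; rewrite perm_catC.
Qed.

Lemma uniq_lambda_word l K T : uniq l -> uniq (lambda_word l K T).
Proof.
move=> ul; suff : proper_word (lambda_word l K T) by case.
apply: (@proper_vword _ l K T ul); apply/seq.permP => p.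
rewrite /vword /lambda_word !count_cat.
move: (count p (desc false l K)) (count p (asc false l K)).
move: (count p (desc true l T)) (count p (asc true l T)) => a b c d; lia.
Qed.

(** If x is in K only, its two sides run parallel to those of y and merge with them; if x is in T
    only, they are adjacent and cancel. *)
Lemma has_genus_crossed_word_cons_neq x y l K T g :
    uniq (x :: l) -> y.1 \notin map Some (x :: l) -> (x \in K) != (x \in T) ->
    has_genus (crossed_word y l K T) g ->
  has_genus (crossed_word y (x :: l) K T) g.
Proof.
move=> ul yl xKT;
  have := proper_crossed_word ul yl (perm_refl (crossed_word y (x :: l) K T)).
move: xKT; rewrite /crossed_word !desc_cons !asc_cons.
move: (desc _ _ _) (asc _ _ _) (desc _ _ _) (asc _ _ _) => c b a d.
case: (x \in K); case: (x \in T); lazy iota; rewrite ?cat_cons; try by [].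
- move=> _ pw H.
  have E : y :: lit x false :: a ++ (d ++ [:: lit x true]) ++ flip y :: b ++ c =
      y :: lit x false :: (a ++ d) ++ lit x true :: flip y :: (b ++ c).
    by rewrite -!catA cat1s.
  rewrite E in pw *.
  by apply: (@has_genus_merge _ y (lit x false) (a ++ d) (b ++ c)); rewrite // -catA.
move=> _ pw H.
have E : y :: a ++ d ++ flip y :: (b ++ [:: lit x false]) ++ lit x true :: c =
    (y :: a ++ d ++ flip y :: b) ++ lit x false :: lit x true :: c.
  by rewrite !cat_cons -!catA.
rewrite E in pw *; apply: has_genus_cancel_mid => //.
by rewrite cat_cons -!catA.
Qed.

(** Here x and its inverse are separated by y and [flip y], which makes a handle; what remains is a
    rotation of R_1 R_4 R_3 R_2. *)
Lemma has_genus_crossed_word_cons_eq x y l K T g :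
    uniq (x :: l) -> y.1 \notin map Some (x :: l) -> (x \in K) = (x \in T) ->
    has_genus (lambda_word l K T) g ->
  has_genus (crossed_word y (x :: l) K T) g.+1.
Proof.
move=> ul yl xKT;
  have := proper_crossed_word ul yl (perm_refl (crossed_word y (x :: l) K T)).
have [_ /(@uniq_lambda_word _ K T)] := andP ul; move: xKT.
rewrite /crossed_word /lambda_word !desc_cons !asc_cons.
move: (desc _ _ _) (asc _ _ _) (desc _ _ _) (asc _ _ _) => c b a d.
case: (x \in K); case: (x \in T); lazy iota; rewrite ?cat_cons; try by [].
- move=> _ ulam pw H; rewrite [a ++ _]catA in pw *.
  apply: has_genus_handle_eq => //; rewrite -catA.
  by apply: (@has_genus_catC _ (a ++ d ++ c) b); rewrite -!catA.
move=> _ ulam pw H.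
have E : y :: a ++ (d ++ [:: lit x true]) ++ flip y :: (b ++ [:: lit x false]) ++ c =
    (y :: a ++ d) ++ (lit x true :: flip y :: b ++ lit x false :: c).
  by rewrite cat_cons -!catA.
rewrite E in pw *; apply: has_genus_rot => //.
have E' : (lit x true :: flip y :: b ++ lit x false :: c) ++ y :: a ++ d =
   lit x true :: flip y :: b ++ lit x false :: c ++ y :: (a ++ d).
  by rewrite !cat_cons -!catA.
rewrite E'; apply: has_genus_handle_eq; rewrite ?flipK //.
  by rewrite -E'; apply: proper_perm pw; rewrite perm_catC.
rewrite [c ++ _]catA.
by apply: has_genus_catC; rewrite -catA.
Qed.

End Families.

Lemma has_genus_word_genus n (w : seq (letter n)) :
  (exists g, has_genus w g) -> has_genus w (word_genus w).
Proof. by move=> [g gw]; rewrite (has_genusE gw). Qed.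

Lemma has_genus_nil n : has_genus ([::] : seq (letter n)) 0.
Proof.
rewrite /has_genus /vertices eqxx addn0; congr (_ + _).
by apply: eq_card0 => z; rewrite !inE andbF.
Qed.

Section FamilyGenus.
Variable n : nat.
Implicit Types (x : 'I_n) (y z : letter n) (l : seq 'I_n) (K T : {set 'I_n}).

Lemma has_genus_pair y : has_genus [:: y; flip y] 0.
Proof.
apply: has_genus_cancel; last exact: has_genus_nil.
split; first by rewrite /= inE eq_sym flip_neq.
exact: flip_closed_pair.
Qed.

(** The reductions of the two shapes lead into each other, so Euler's equation is solved for both by
    one induction. *)
Lemma vword_genus_ex l : uniq l ->
  (forall K T, exists g, has_genus (vword l K T) g) /\
  (forall y K T, y.1 \notin map Some l ->
    exists g, has_genus (barred_vword y l K T) g).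
Proof.
elim: l => [|x l IH] ul.
  split=> [K T|y K T _]; exists 0; [exact: has_genus_nil|exact: has_genus_pair].
have [_ ul'] := andP ul; have [IHv IHb] := IH ul'.
have xl b : (lit x b).1 \notin map Some l.
  by have [xl _] := andP ul; apply: contra xl => /mapP[x' + [->]].
split=> [K T|y K T yl]; last first.
  by have [g /(has_genus_barred_vword_cons ul yl)] := IHv K T; exists g.+1.
suff [g gP] : exists g, has_genus (
    if x \in K then
      if x \in T then barred_vword (lit x false) l K T else vword l K T
    else
      if x \in T then vword l K T else barred_vword (lit x true) l K T) g.
  by exists g; exact: has_genus_vword_cons.
by do 2!case: ifP => _; (exact: IHv || exact: IHb).
Qed.

Lemma vword_genus l K T : uniq l ->
  has_genus (vword l K T) (word_genus (vword l K T)).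
Proof. by move=> /vword_genus_ex[/(_ K T)/has_genus_word_genus]. Qed.

Lemma word_genus_vword_cons x l K T : uniq (x :: l) ->
  word_genus (vword (x :: l) K T) =
  if x \in K then
    if x \in T then word_genus (barred_vword (lit x false) l K T)
    else word_genus (vword l K T)
  else
    if x \in T then word_genus (vword l K T)
    else word_genus (barred_vword (lit x true) l K T).
Proof.
move=> ul; apply: has_genusE; apply: has_genus_vword_cons => //.
have [xl ul'] := andP ul; have [IHv IHb] := vword_genus_ex ul'.
do 2!case: ifP => _; apply: has_genus_word_genus; (apply: IHv || apply: IHb).
  by apply: contra xl => /mapP[x' + [->]].
by apply: contra xl => /mapP[x' + [->]].
Qed.

Lemma word_genus_barred_vword_cons x y l K T :
    uniq (x :: l) -> y.1 \notin map Some (x :: l) ->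
  word_genus (barred_vword y (x :: l) K T) = (word_genus (vword l K T)).+1.
Proof.
move=> ul yl; apply: has_genusE; apply: has_genus_barred_vword_cons => //.
by apply: vword_genus; case/andP: ul.
Qed.

Lemma desc_rev_setC s l K : desc s (rev l) (~: K) = asc s l K.
Proof.
rewrite /desc /asc filter_rev map_rev; congr (rev (map _ _)).
by apply: eq_filter => x; rewrite inE.
Qed.

Lemma asc_rev_setC s l K : asc s (rev l) (~: K) = desc s l K.
Proof.
rewrite /desc /asc filter_rev map_rev revK; congr map.
by apply: eq_filter => x; rewrite inE negbK.
Qed.

(* Reversing the order of the indices exchanges [desc] and [asc], up to a
   complement, and turns a word of shape R_1 R_4 R_3 R_2 into a rotation of
   one of shape R_1 R_2 R_3 R_4. *)
Lemma lambda_word_genus l K T : uniq l ->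
  has_genus (lambda_word l K T) (word_genus (vword (rev l) (~: K) (~: T))).
Proof.
move=> ul; have ur : uniq (rev l) by rewrite rev_uniq.
have := vword_genus (~: K) (~: T) ur; set g := word_genus _.
have := uniq_lambda_word K T ul.
rewrite /lambda_word /vword !desc_rev_setC !asc_rev_setC.
move: (desc _ _ _) (asc _ _ _) (desc _ _ _) (asc _ _ _) => c b a d ulam H.
have -> : a ++ d ++ c ++ b = (a ++ d ++ c) ++ b by rewrite -!catA.
apply: has_genus_catC => //.
by rewrite uniq_catC -!catA.
Qed.

Lemma crossed_word_genus y l K T : uniq l -> y.1 \notin map Some l ->
  has_genus (crossed_word y l K T) (word_genus (crossed_word y l K T)).
Proof.
move=> ul yl; apply: has_genus_word_genus.
elim: l ul yl => [|x l IH] ul yl; first by exists 0; exact: has_genus_pair.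
have [_ ul'] := andP ul; have [xKT|xKT] := eqVneq (x \in K) (x \in T).
  have := lambda_word_genus K T ul'; set g := word_genus _ => H.
  by exists g.+1; exact: has_genus_crossed_word_cons_eq.
have [|g gP] := IH ul'; last first.
  by exists g; exact: has_genus_crossed_word_cons_neq.
by move: yl; rewrite /= inE negb_or => /andP[].
Qed.

Lemma word_genus_crossed_word_cons x y l K T :
    uniq (x :: l) -> y.1 \notin map Some (x :: l) ->
  word_genus (crossed_word y (x :: l) K T) =
  if (x \in K) == (x \in T) then (word_genus (vword (rev l) (~: K) (~: T))).+1
  else word_genus (crossed_word y l K T).
Proof.
move=> ul yl; apply: has_genusE; have [_ ul'] := andP ul.
case: eqVneq => xKT.
  by apply: has_genus_crossed_word_cons_eq => //; exact: lambda_word_genus.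
apply: has_genus_crossed_word_cons_neq => //; apply: crossed_word_genus => //.
by move: yl; rewrite /= inE negb_or => /andP[].
Qed.

Lemma eq_vword l K K' T T' : {in l, K =i K'} -> {in l, T =i T'} ->
  vword l K T = vword l K' T'.
Proof.
by move=> KK TT; rewrite /vword !(eq_desc _ KK) !(eq_desc _ TT)
  !(eq_asc _ KK) !(eq_asc _ TT).
Qed.

Lemma eq_barred_vword y l K K' T T' : {in l, K =i K'} -> {in l, T =i T'} ->
  barred_vword y l K T = barred_vword y l K' T'.
Proof.
by move=> KK TT; rewrite /barred_vword !(eq_desc _ KK) !(eq_desc _ TT)
  !(eq_asc _ KK) !(eq_asc _ TT).
Qed.

Lemma eq_crossed_word y l K K' T T' : {in l, K =i K'} -> {in l, T =i T'} ->
  crossed_word y l K T = crossed_word y l K' T'.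
Proof.
by move=> KK TT; rewrite /crossed_word !(eq_desc _ KK) !(eq_desc _ TT)
  !(eq_asc _ KK) !(eq_asc _ TT).
Qed.

End FamilyGenus.

(** * Generating polynomials and their recurrences *)

Local Open Scope ring_scope.

Lemma big_powersetU1 (I : finType) (R : nmodType) (x : I) (S : {set I})
    (G : {set I} -> R) : x \notin S ->
  \sum_(K in powerset (x |: S)) G K =
  \sum_(K in powerset S) (G (x |: K) + G K).
Proof.
move=> xS; rewrite big_split/= (bigID (fun K : {set I} => x \in K))/=; congr (_ + _).
  rewrite (reindex_onto (fun K => x |: K) (fun K => K :\ x)); last first.
    by move=> K /andP[_ xK]; rewrite setD1K.
  apply: eq_bigl => K; rewrite !inE eqxx /= andbT.
  apply/andP/idP => [[KS /eqP <-]|KS].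
    by apply/subsetP => z; rewrite !inE => /andP[zx]; move/subsetP: KS => /(_ z);
      rewrite !inE (negbTE zx).
  have xK : x \notin K by apply: contra xS; exact: (subsetP KS).
  by rewrite setUS// setU1K.
apply: eq_bigl => K; rewrite !inE; apply/andP/idP => [[KS xK]|KS].
  apply/subsetP => z zK; move/subsetP: KS => /(_ z zK); rewrite !inE.
  by case: eqP => // zx; rewrite -zx zK in xK.
split; first exact: subset_trans KS (subsetUr _ _).
by apply: contra xS; exact: (subsetP KS).
Qed.

Section Sums.
Variable n : nat.
Implicit Types (x : 'I_n) (y z : letter n) (l : seq 'I_n) (K T S : {set 'I_n}).
Implicit Types (F : {set 'I_n} -> {set 'I_n} -> {poly nat}).

(** Only subsets of the indices in [l] are summed over, so that letters can be peeled off [l] while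
    the ambient n stays fixed. *)
Definition psum l F : {poly nat} :=
  \sum_(K in powerset [set x in l]) \sum_(T in powerset [set x in l]) F K T.

Lemma eq_psum l F F' :
    (forall K T, K \subset [set x in l] -> T \subset [set x in l] ->
      F K T = F' K T) ->
  psum l F = psum l F'.
Proof.
move=> FF'; apply: eq_bigr => K; rewrite powersetE => Kl; apply: eq_bigr => T.
by rewrite powersetE => Tl; exact: FF'.
Qed.

Lemma psumD l F F' : psum l (fun K T => F K T + F' K T) = psum l F + psum l F'.
Proof. by rewrite -big_split; apply: eq_bigr => K _; rewrite -big_split. Qed.

Lemma psumMX l F : psum l (fun K T => F K T * 'X) = psum l F * 'X.
Proof. by rewrite mulr_suml; apply: eq_bigr => K _; rewrite mulr_suml. Qed.

Lemma psum_cons x l F : x \notin l ->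
  psum (x :: l) F =
  psum l (fun K T => F (x |: K) (x |: T) + F (x |: K) T
                     + (F K (x |: T) + F K T)).
Proof.
move=> xl; have xS : x \notin [set z in l] by rewrite inE.
rewrite /psum set_cons big_powersetU1//; apply: eq_bigr => K _.
by rewrite !big_powersetU1// -big_split.
Qed.

Lemma psum_nil F : psum [::] F = F set0 set0.
Proof.
have E : powerset [set x in [::]] = [set set0 : {set 'I_n}].
  by rewrite -powerset0; congr powerset; apply/setP => x; rewrite !inE.
by rewrite /psum E !big_set1.
Qed.

(** The full complement leaves the powerset of [l], but F sees only membership in [l], so it may be
    replaced by the complement relative to [l], an involution of that powerset. *)
Lemma psum_setC l F :
    (forall K K' T T', {in l, K =i K'} -> {in l, T =i T'} -> F K T = F K' T') ->
  psum l (fun K T => F (~: K) (~: T)) = psum l F.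
Proof.
move=> Floc; set S := [set x in l].
have reind (G : {set 'I_n} -> {poly nat}) :
    \sum_(K in powerset S) G K = \sum_(K in powerset S) G (S :\: K).
  rewrite (reindex_onto (fun K => S :\: K) (fun K => S :\: K)); last first.
    by move=> K; rewrite powersetE => KS; rewrite setDDr setDv set0U; apply/setIidPr.
  apply: eq_bigl => K; rewrite !powersetE subsetDl /=.
  by rewrite setDDr setDv set0U; apply/eqP/idP => [<-|/setIidPr//]; exact: subsetIl.
rewrite [RHS]/psum [RHS]reind; apply: eq_bigr => K _; rewrite [RHS]reind.
by apply: eq_bigr => T _; apply: Floc => x xl; rewrite !inE xl andbT.
Qed.

Lemma in_setU1_notin x l K : x \notin l -> {in l, x |: K =i K}.
Proof. by move=> xl z zl; rewrite !inE; case: eqP => // zx; rewrite -zx zl in xl. Qed.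

Definition vpoly l := psum l (fun K T => 'X^(word_genus (vword l K T))).
Definition barred_vpoly y l :=
  psum l (fun K T => 'X^(word_genus (barred_vword y l K T))).
Definition crossed_poly y l :=
  psum l (fun K T => 'X^(word_genus (crossed_word y l K T))).

Lemma vpoly_cons x l : uniq (x :: l) ->
  vpoly (x :: l) =
  barred_vpoly (lit x false) l + vpoly l + (vpoly l + barred_vpoly (lit x true) l).
Proof.
move=> ul; have [xl _] := andP ul.
rewrite /vpoly psum_cons// /barred_vpoly -!psumD; apply: eq_psum => K T KS TS.
have xK : x \in K = false by apply: contraNF xl => /(subsetP KS); rewrite inE.
have xT : x \in T = false by apply: contraNF xl => /(subsetP TS); rewrite inE.
rewrite !word_genus_vword_cons// !setU11 xK xT.
have HK := in_setU1_notin K xl; have HT := in_setU1_notin T xl.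
by rewrite (eq_barred_vword _ HK HT) !(eq_vword HK (fun=> fun=> erefl))
  !(eq_vword (fun=> fun=> erefl) HT).
Qed.

Lemma barred_vpoly_cons x y l :
    uniq (x :: l) -> y.1 \notin map Some (x :: l) ->
  barred_vpoly y (x :: l) = vpoly l * 'X *+ 4.
Proof.
move=> ul yl; have [xl _] := andP ul.
rewrite /barred_vpoly psum_cons// -psumMX !mulrS mulr0n addr0 !addrA -!psumD.
apply: eq_psum => K T _ _; rewrite !word_genus_barred_vword_cons//.
have HK := in_setU1_notin K xl; have HT := in_setU1_notin T xl.
rewrite (eq_vword HK HT) !(eq_vword HK (fun=> fun=> erefl))
  !(eq_vword (fun=> fun=> erefl) HT).
by rewrite -exprSr !addrA.
Qed.

(** Of the four memberships of x in K and T, two create a handle and two let x vanish. The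
    complements brought in by the reversal of [l] are absorbed by summing over all K and T. *)
Lemma crossed_poly_cons x y l :
    uniq (x :: l) -> y.1 \notin map Some (x :: l) ->
  crossed_poly y (x :: l) = crossed_poly y l *+ 2 + vpoly (rev l) * 'X *+ 2.
Proof.
move=> ul yl; have [xl _] := andP ul.
have rl : [set z in rev l] = [set z in l] by apply/setP => z; rewrite !inE mem_rev.
have -> : vpoly (rev l) =
    psum l (fun K T => 'X^(word_genus (vword (rev l) (~: K) (~: T)))).
  rewrite /vpoly /psum rl -/(psum l _).
  rewrite -(@psum_setC l (fun K T => 'X^(word_genus (vword (rev l) K T))))//.
  move=> K K' T T' KK TT; congr ('X^(word_genus _)); apply: eq_vword => z;
    by rewrite mem_rev => ?; rewrite ?KK ?TT.
rewrite /crossed_poly psum_cons// -psumMX !mulr2n -!psumD.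
apply: eq_psum => K T KS TS; rewrite !word_genus_crossed_word_cons// !setU11.
have xK : x \in K = false by apply: contraNF xl => /(subsetP KS); rewrite inE.
have xT : x \in T = false by apply: contraNF xl => /(subsetP TS); rewrite inE.
rewrite xK xT /=.
have HK := in_setU1_notin K xl; have HT := in_setU1_notin T xl.
rewrite !(eq_crossed_word _ HK (fun=> fun=> erefl))
  !(eq_crossed_word _ (fun=> fun=> erefl) HT).
have CK : {in rev l, ~: (x |: K) =i ~: K}.
  by move=> z; rewrite mem_rev inE => zl; rewrite HK// inE.
have CT : {in rev l, ~: (x |: T) =i ~: T}.
  by move=> z; rewrite mem_rev inE => zl; rewrite HT// inE.
rewrite (eq_vword CK CT) -exprSr.
by rewrite [X in X + _ = _]addrC addrACA.
Qed.

Lemma vpoly_ladder_polys l : uniq l -> vpoly l = (ladder_polys (size l)).2.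
Proof.
move: l; suff H m : forall l, (size l < m)%N -> uniq l ->
    vpoly l = (ladder_polys (size l)).2 by move=> l; exact: H (ltnSn _).
(* The recurrence reaches back two letters, hence the induction on a bound for the size. Each of the
   two barred polynomials contributes 4 x A_(n-2), whence the 8. *)
elim: m => // m IH [|x [|x' l]] lm ul.
- by rewrite /vpoly psum_nil (has_genusE (@has_genus_nil n)).
- rewrite vpoly_cons// /vpoly /barred_vpoly !psum_nil.
  rewrite (has_genusE (@has_genus_nil n)) !(has_genusE (has_genus_pair _)).
  by rewrite /= !mulrS mulr0n addr0 !addrA.
have [xl ul'] := andP ul; have [x'l ul''] := andP ul'.
have bE b : barred_vpoly (lit x b) (x' :: l) = vpoly l * 'X *+ 4.
  apply: barred_vpoly_cons => //.
  by apply: contra xl => /mapP[z + [->]].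
rewrite vpoly_cons// !bE !IH//=; last by rewrite ltnW.
case: (ladder_polys (size l)) => p q /=.
by rewrite [X in X + _ = _]addrC addrACA -mulrnDr mulr2n.
Qed.

Lemma crossed_poly_ladder_polys y l : uniq l -> y.1 \notin map Some l ->
  crossed_poly y l *+ 4 = (ladder_polys (size l)).1.
Proof.
elim: l => [|x l IH] ul yl.
  by rewrite /crossed_poly psum_nil (has_genusE (has_genus_pair y)) expr0.
have [_ ul'] := andP ul.
rewrite crossed_poly_cons// mulrnDl mulrnAC IH//; last first.
  by move: yl; rewrite /= inE negb_or => /andP[].
rewrite vpoly_ladder_polys ?rev_uniq// size_rev /=.
by case: (ladder_polys (size l)) => p q /=; rewrite -mulrnA.
Qed.

Lemma surface_polyE (word : {set 'I_n} -> {set 'I_n} -> seq (letter n)) :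
  surface_poly word = \sum_K \sum_T 'X^(word_genus (word K T)).
Proof.
rewrite pair_bigA /=; apply/polyP => i.
have -> : (\sum_p 'X^(word_genus (word p.1 p.2)) : {poly nat})`_i = surfaces word i.
  rewrite coef_sum /surfaces cardsE -sum1_card [RHS]big_mkcond /=.
  by apply: eq_bigr => p _; rewrite coefXn eq_sym unfold_in -[eqn _ _]/(_ == _); case: (_ == i).
rewrite /surface_poly coef_sum.
set m := \max_KT _.
have [im|mi] := ltnP i m.+1.
  rewrite (bigD1_seq i) ?iota_uniq ?mem_index_iota//= coefZ coefXn eqxx mulr1.
  rewrite big1 ?addr0// => j ji.
  by rewrite coefZ coefXn eq_sym (negbTE ji) mulr0.
rewrite big_nat big1 => [|j jm]; last first.
  rewrite coefZ coefXn; case: eqP => [ij|_]; last by rewrite mulr0.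
  by move: jm; rewrite -ij ltnNge mi andbF.
apply/esym/eqP; rewrite cards_eq0; apply/eqP/setP => p; rewrite !inE.
apply/negbTE; rewrite neq_ltn; apply/orP; left; apply: leq_trans mi.
by rewrite ltnS; exact: (leq_bigmax p).
Qed.

Lemma enum_setE K : enum K = [seq x <- enum 'I_n | x \in K].
Proof. by rewrite {1}/enum_mem -enumT. Qed.

Lemma R1E K : R1 K = desc false (rev (enum 'I_n)) K.
Proof. by rewrite /R1 /desc filter_rev enum_setE. Qed.

Lemma R2E K : R2 K = asc false (rev (enum 'I_n)) K.
Proof.
rewrite /R2 /asc filter_rev map_rev revK enum_setE; congr map.
by apply: eq_filter => x; rewrite inE.
Qed.

Lemma R3E K : R3 K = desc true (rev (enum 'I_n)) K.
Proof. by rewrite /R3 /desc filter_rev enum_setE. Qed.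

Lemma R4E K : R4 K = asc true (rev (enum 'I_n)) K.
Proof.
rewrite /R4 /asc filter_rev map_rev revK enum_setE; congr map.
by apply: eq_filter => x; rewrite inE.
Qed.

Lemma psum_enum F : psum (rev (enum 'I_n)) F = \sum_K \sum_T F K T.
Proof.
have E : powerset [set x in rev (enum 'I_n)] =i predT.
  by move=> K; rewrite powersetE; apply/subsetP => x _; rewrite inE mem_rev mem_enum.
by rewrite /psum (eq_bigl _ _ E); apply: eq_bigr => K _; rewrite (eq_bigl _ _ E).
Qed.

End Sums.

Lemma fS1E (n : nat) : fS1 n = (ladder_polys n).2.
Proof.
have u : uniq (rev (enum 'I_n)) by rewrite rev_uniq enum_uniq.
have := vpoly_ladder_polys u.
rewrite size_rev -cardE card_ord => <-; rewrite /fS1 surface_polyE /vpoly psum_enum.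
by apply: eq_bigr => K _; apply: eq_bigr => T _; rewrite /word1 R1E R2E R3E R4E.
Qed.

Lemma fS6E (n : nat) : fS6 n *+ 4 = (ladder_polys n).1.
Proof.
have u : uniq (rev (enum 'I_n)) by rewrite rev_uniq enum_uniq.
have := @crossed_poly_ladder_polys n (None, false) _ u.
rewrite size_rev -cardE card_ord => <-; last by apply/mapP => -[].
congr (_ *+ _); rewrite /fS6 surface_polyE /crossed_poly psum_enum.
by apply: eq_bigr => K _; apply: eq_bigr => T _; rewrite /word6 R1E R2E R3E R4E.
Qed.

Lemma surface_poly_pf2 (n : nat) (fS : {poly nat}) :
  fS = fS1 n \/ fS = fS6 n -> pf2 (nth 0 fS) /\ fS`_0 != 0.
Proof.
have [f0 pf _ _ _] := ladder_polys_interlaced n.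
have mulnE a b : (a : nat) *+ b = (b * a)%N by rewrite -mulr_natl natn.
case=> ->.
  (* Interlacing gives a positive constant term only for the first component, so for n+1 the second
     component is read as the first one at n. *)
  rewrite fS1E; case: n {f0 pf} => [|n].
    rewrite /= polyseq1; split=> // i j; case: i => [|[|i]]; case: j => [|[|j]] //.
  have [f0 pf _ _ _] := ladder_polys_interlaced n.
  rewrite /=; case: (ladder_polys n) f0 pf => p q /= f0 pf.
  by split=> //; rewrite -lt0n.
have cE i : (ladder_polys n).1`_i = (4 * nth 0 (fS6 n) i)%N.
  by rewrite -fS6E coefMn mulnE.
split; first exact: (@pf2_scale 4 _ _ isT cE pf).
by move: f0; rewrite cE muln_gt0 => /andP[_]; rewrite lt0n.
Qed.

Lemma log_concave_all (p : {poly nat}) : log_concave p ->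
  forall i, (nth 0 p i * nth 0 p i.+2 <= nth 0 p i.+1 ^ 2)%N.
Proof.
move=> lc i; have [/lc//|pi] := ltnP i.+2 (size p).
by rewrite [nth _ _ i.+2]nth_default// muln0.
Qed.

Local Close Scope ring_scope.

Theorem theorem4p4 (G0 : graph) (e0 e1 : edge G0) (n : nat) (Gn : graph)
    (fS : {poly nat}) (hconn : connected_graph G0) (he : e0 != e1)
    (hn : 0 < n)
    (hG : Gn = ladder e0 e1 n \/ Gn = cross e0 e1 n)
    (hS : fS = fS1 n \/ fS = fS6 n)
    (hf : genus_poly Gn = (genus_poly G0 * fS)%R) :
  (log_concave (genus_poly G0) -> log_concave (genus_poly Gn)) /\
  (unimodal (genus_poly G0) -> unimodal (genus_poly Gn)).
Proof.
have [pf0 f0] := surface_poly_pf2 hS.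
rewrite hf; split=> [lc|]; last exact: pf2_mul_unimodal.
apply: pf2_mul_log_concave => //; apply: pf2_log_concave.
  exact: genus_poly_no_gap.
exact: log_concave_all.
Qed.
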